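(* Let $\nu\in(0,1/2]$ and $f\in(0,1/2]$ be fixed constants. There exist constants $C>0$ and $N_0$, depending only on $\nu$ and $f$, such that the following holds for all integers $N\ge N_0$ for which $n:=\nu N$ and $L:=fN$ are integers. Let $A\subseteq[N]$ be any subsystem of $L$ modes, let $H=Q+\epsilon_1H_{\mathrm{SYK2}}+\epsilon_1\epsilon_2H_{\mathrm{SYK4}}$ be the Hamiltonian defined in the context with $\epsilon_1,\epsilon_2\in\mathbb R$, and for each $n$-element subset $R\subseteq[N]$ let $|\psi_R\rangle:=\big(\prod_{j\in R}a_j^\dagger\big)|0\rangle$, $\psi_R(t):=e^{-iHt}|\psi_R\rangle\langle\psi_R|e^{iHt}$ and $\psi_R(t)_A:=\mathrm{tr}_{\bar A}\psi_R(t)$. Then for every Hermitian matrix $h$, every choice of complex coefficients $J$, and every $t\in\mathbb R$, $$\frac1{\binom Nn}\sum_{R\subseteq[N],\,|R|=n}S(\psi_R(t)_A)\le H_b(\nu)L-\delta_{f,\frac12}\left|\ln\frac{1-\nu}{\nu}\right|\sqrt{\frac{\nu(1-\nu)N}{2\pi}}+\frac{f+\ln(1-f)}2+\frac{C\,\delta_{f,\frac12}}{\sqrt L}+\frac{C}{L},$$ where $\delta$ is the Kronecker delta.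
   Context: Fermionic system: $N$ modes with annihilation and creation operators $a_j,a_j^\dagger$ ($j\in[N]:=\{1,\dots,N\}$) satisfying the canonical anticommutation relations on the $2^N$-dimensional Fock space with vacuum $|0\rangle$. $Q:=\sum_{j=1}^Na_j^\dagger a_j$ is the fermion number operator. $H_{\mathrm{SYK2}}:=a^\dagger ha=\sum_{j,k}h_{jk}a_j^\dagger a_k$, where $a=(a_1,\dots,a_N)^T$ and $h$ is an $N\times N$ Hermitian matrix. $H_{\mathrm{SYK4}}:=\sum_{(j,k,l,m)\in\mathcal I}J_{jklm}a_j^\dagger a_k^\dagger a_la_m+\text{H.c.}$ (H.c. = Hermitian conjugate), where $\mathcal I:=\{(j,k,l,m)\in[N]^4: j<k,\ l<m,\ jN+k\le lN+m\}$ and $J=\{J_{jklm}\}_{(j,k,l,m)\in\mathcal I}$ is a collection of complex numbers. For a subsystem (set of modes) $A$ with complement $\bar A$ and a state $\rho$ that is a mixture of states with definite fermion number, $\rho_A:=\mathrm{tr}_{\bar A}\rho$ is the reduced density matrix: the density operator on the $2^{|A|}$-dimensional Fock space of the modes in $A$ with $\mathrm{tr}(\rho_AB)=\mathrm{tr}(\rho B)$ for every $B$ in the algebra generated by $\{a_j,a_j^\dagger\}_{j\in A}$. $S(\rho)=-\mathrm{tr}(\rho\ln\rho)$ is the von Neumann entropy. $H_b(\nu):=-\nu\ln\nu-(1-\nu)\ln(1-\nu)$. *)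

(* Defs.v *)
From HB Require Import structures.
From mathcomp Require Import all_boot all_order all_algebra.
From mathcomp Require Import sesquilinear spectral complex.
From mathcomp Require Import all_classical all_reals all_analysis.
From mathcomp Require Import ring.

Set Implicit Arguments.
Unset Strict Implicit.
Unset Printing Implicit Defensive.

Import Order.TTheory GRing.Theory Num.Theory.
Import numFieldNormedType.Exports.

Local Open Scope ring_scope.
Local Open Scope complex_scope.
Local Open Scope sesquilinear_scope.

Definition expmx (K : numFieldType) d (A : 'M[K]_d) : 'M[K]_d :=
  limn (series (fun k : nat => (k`!%:R)^-1 *: A ^+ k)).

Section MatrixFunctions.
Variable R : realType.

(* Functional calculus g(A) of a Hermitian A; the spectrum is then real, so
   that taking the real part of the eigenvalues only serves the typing. *)
Definition mxfun d (g : R -> R) (A : 'M[R[i]]_d) : 'M[R[i]]_d :=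
  invmx (spectralmx A)
    *m diag_mx (map_mx (fun z : R[i] => (g (complex.Re z))%:C) (spectral_diag A))
    *m spectralmx A.

(* The library's ln vanishes at 0, which gives the convention 0 ln 0 = 0. *)
Definition vn_entropy d (rho : 'M[R[i]]_d) : R :=
  - complex.Re (\tr (rho *m mxfun (@ln R) rho)).

Definition binary_entropy (x : R) : R :=
  - x * ln x - (1 - x) * ln (1 - x).

End MatrixFunctions.

Section Fock.
Variable R : realType.

(* The occupation-number basis of the Fock space of N modes is indexed by the
   sets of occupied modes. *)
Definition fock_dim (N : nat) : nat := #|{set 'I_N}|.

Lemma fock_dimE N : fock_dim N = (2 ^ N)%N.
Proof.
by rewrite /fock_dim -finset.cardsT -finset.powersetT finset.card_powerset
  finset.cardsT card_ord.
Qed.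

Definition vacuum N : 'cV[R[i]]_(fock_dim N) := delta_mx (enum_rank finset.set0) 0.

(* a_j |T> = (-1)^#{k in T : k < j} |T \ j> if j \in T, and 0 otherwise. *)
Definition annih N (j : 'I_N) : 'M[R[i]]_(fock_dim N) :=
  \matrix_(x, y)
    (let S : {set 'I_N} := enum_val x in let T : {set 'I_N} := enum_val y in
     if (j \in T) && (S == T :\ j)
     then (-1) ^+ #|[set k in T | (k < j)%N]| else 0).

Definition creat N (j : 'I_N) : 'M[R[i]]_(fock_dim N) := (annih j)^t*.

Definition number_op N : 'M[R[i]]_(fock_dim N) :=
  \sum_(j < N) creat j *m annih j.

Definition H_SYK2 N (h : 'M[R[i]]_N) : 'M[R[i]]_(fock_dim N) :=
  \sum_(j < N) \sum_(k < N) h j k *: (creat j *m annih k).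

(* Modes are numbered from 0, which shifts both sides of j N + k <= l N + m
   by N + 1. Only the values of J on the index set of the sum matter. *)
Definition SYK4_half N (J : 'I_N -> 'I_N -> 'I_N -> 'I_N -> R[i]) :
    'M[R[i]]_(fock_dim N) :=
  \sum_(j < N) \sum_(k < N) \sum_(l < N)
    \sum_(m < N | [&& (j < k)%N, (l < m)%N & (j * N + k <= l * N + m)%N])
      J j k l m *: (creat j *m creat k *m annih l *m annih m).

Definition H_SYK4 N (J : 'I_N -> 'I_N -> 'I_N -> 'I_N -> R[i]) :
    'M[R[i]]_(fock_dim N) :=
  SYK4_half J + (SYK4_half J)^t*.

Definition hamiltonian N (eps1 eps2 : R) (h : 'M[R[i]]_N)
    (J : 'I_N -> 'I_N -> 'I_N -> 'I_N -> R[i]) : 'M[R[i]]_(fock_dim N) :=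
  number_op N + eps1%:C *: H_SYK2 h + (eps1 * eps2)%:C *: H_SYK4 J.

(* The product is taken in increasing order of the modes; another order could
   only change the sign of the vector. *)
Definition slater N (S : {set 'I_N}) : 'cV[R[i]]_(fock_dim N) :=
  (\prod_(j in S) creat j) *m vacuum N.

Definition evolved_state d (H : 'M[R[i]]_d) (psi : 'cV[R[i]]_d) (t : R) :
    'M[R[i]]_d :=
  expmx (- ('i * t%:C) *: H) *m (psi *m psi^t*) *m expmx (('i * t%:C) *: H).

(* The Fock space of the modes of A is that of #|A| modes, the i-th one
   standing for the i-th mode of A, enum_val i. [local_op A B B'] says that B'
   belongs to the algebra generated by the a_j, a_j^dagger with j \in A and
   that it acts as B on the Fock space of the modes of A. *)
Inductive local_op N (A : {set 'I_N}) :
    'M[R[i]]_(fock_dim #|A|) -> 'M[R[i]]_(fock_dim N) -> Prop :=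
| local_annih (i : 'I_#|A|) : local_op (annih i) (annih (enum_val i))
| local_creat (i : 'I_#|A|) : local_op (creat i) (creat (enum_val i))
| local_one : local_op 1%:M 1%:M
| local_add B1 B1' B2 B2' :
    local_op B1 B1' -> local_op B2 B2' -> local_op (B1 + B2) (B1' + B2')
| local_scale (c : R[i]) B B' : local_op B B' -> local_op (c *: B) (c *: B')
| local_mul B1 B1' B2 B2' :
    local_op B1 B1' -> local_op B2 B2' -> local_op (B1 *m B2) (B1' *m B2').

Definition is_reduced N (A : {set 'I_N}) (rho : 'M[R[i]]_(fock_dim N))
    (rhoA : 'M[R[i]]_(fock_dim #|A|)) : Prop :=
  forall B B', local_op B B' -> \tr (rhoA *m B) = \tr (rho *m B').

(* The unique operator satisfying is_reduced, by reducedP and reduced_unique. *)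
Definition reduced N (A : {set 'I_N}) (rho : 'M[R[i]]_(fock_dim N)) :
    'M[R[i]]_(fock_dim #|A|) :=
  xget 0 [set rhoA | is_reduced rho rhoA]%classic.

Section WellDefined.
Import finset.

Local Notation rk S := (enum_rank (S : {set 'I__}) : 'I_(fock_dim _)).

Lemma fock_sum N (V : nmodType) (F : 'I_(fock_dim N) -> V) :
  \sum_z F z = \sum_(Z : {set 'I_N}) F (rk Z).
Proof.
rewrite (reindex (fun Z : {set 'I_N} => rk Z)) //=.
exact/onW_bij/enum_rank_bij.
Qed.

Lemma annihE N j (S T : {set 'I_N}) : annih j (rk S) (rk T) =
  if (j \in T) && (S == T :\ j) then (-1) ^+ #|[set k in T | (k < j)%N]| else 0.
Proof. by rewrite mxE /= !enum_rankK. Qed.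

Lemma fock_mxP N (A B : 'M[R[i]]_(fock_dim N)) :
  (forall S T : {set 'I_N}, A (rk S) (rk T) = B (rk S) (rk T)) -> A = B.
Proof.
move=> H; apply/matrixP=> x y.
by move: (H (enum_val x) (enum_val y)); rewrite !enum_valK.
Qed.

Section MatrixUnits.
Variables (n : nat) (P : 'M[R[i]]_(fock_dim n) -> Prop).
Hypotheses (Pa : forall j, P (annih j)) (Pc : forall j, P (creat j)) (P1 : P 1%:M)
 (PD : forall a b, P a -> P b -> P (a + b)) (PZ : forall c a, P a -> P (c *: a))
 (PM : forall a b, P a -> P b -> P (a *m b)).

Lemma eq_setD1 j (S T : {set 'I_n}) : j \in S -> j \in T -> (S :\ j == T :\ j) = (S == T).
Proof.
move=> jS jT; apply/eqP/eqP => [h|->//]; by rewrite -[S](finset.setD1K jS) h finset.setD1K.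
Qed.

Lemma creatE (j : 'I_n) (S T : {set 'I_n}) : creat j (rk S) (rk T) =
  if (j \in S) && (T == S :\ j) then (-1) ^+ #|[set k in S | (k < j)%N]| else 0.
Proof.
rewrite /creat 2!mxE annihE; case: ifP => _; by rewrite ?rmorph_sign ?rmorph0.
Qed.

Lemma numberE (j : 'I_n) (S T : {set 'I_n}) : (creat j *m annih j) (rk S) (rk T) =
  ((S == T) && (j \in S))%:R.
Proof.
rewrite mxE fock_sum; under eq_bigr => Z _ do rewrite creatE annihE.
case: (boolP (j \in S)) => jS /=; last by rewrite andbF big1 // => Z _; rewrite mul0r.
rewrite (bigD1 (S :\ j)) //= eqxx big1 ?addr0; last by move=> Z /negbTE ->; rewrite mul0r.
case: (boolP (j \in T)) => jT /=; last first.
  rewrite mulr0 andbT; case: eqP => // e; by rewrite -e jS in jT.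
rewrite eq_setD1 // andbT; case: eqP => [->|_]; last by rewrite mulr0.
by rewrite -expr2 sqrr_sign.
Qed.

Lemma vacancy_projector (s : seq 'I_n) : exists2 B, P B &
  forall S T : {set 'I_n}, B (rk S) (rk T) = ((S == T) && ~~ has (mem S) s)%:R.
Proof.
elim: s => [|j s [B PB hB]].
  exists 1%:M => // S T; by rewrite mxE (inj_eq enum_rank_inj) andbT.
exists ((1%:M + (-1) *: (creat j *m annih j)) *m B).
  by apply: (PM _ PB); apply: (PD P1); apply: PZ; apply: PM.
move=> S T; rewrite mxE fock_sum (bigD1 S) //= big1 ?addr0; last first.
  move=> Z; rewrite eq_sym => /negbTE h.
  by rewrite mxE [in X in _ + X]mxE numberE mxE (inj_eq enum_rank_inj) h mulr0 addr0 mul0r.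
rewrite mxE [in X in _ + X]mxE numberE mxE !eqxx hB /= negb_or.
by case: (j \in S); rewrite /= ?mulr1 ?subrr ?mul0r ?andbF // mulr0 addr0 mul1r.
Qed.

Lemma vacuum_projector : P (delta_mx (rk (finset.set0 : {set 'I_n})) (rk finset.set0)).
Proof.
have [B PB hB] := vacancy_projector (enum 'I_n).
suff <- : B = delta_mx (rk finset.set0) (rk finset.set0) by [].
apply: fock_mxP => S T; rewrite hB mxE !(inj_eq enum_rank_inj).
have -> : ~~ has (mem S) (enum 'I_n) = (S == finset.set0).
  apply/hasPn/eqP => [h|-> j _]; last by rewrite /= finset.in_set0.
  by apply/setP => j; rewrite finset.in_set0; apply/negbTE/h; rewrite mem_enum.
by case: (eqVneq S finset.set0) => [->|]; rewrite ?andbF // andbT eq_sym.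
Qed.

Lemma vacuum_row_unit (T : {set 'I_n}) : P (delta_mx (rk finset.set0) (rk T)).
Proof.
elim: {T}#|T| {-2}T (erefl #|T|) => [|m IH] T.
  by move/eqP; rewrite cards_eq0 => /eqP ->; apply: vacuum_projector.
move=> cT; have [j jT] : exists j, j \in T by apply/set0Pn; rewrite -cards_eq0 cT.
have {}IH : P (delta_mx (rk finset.set0) (rk (T :\ j))).
  by apply: IH; move: cT; rewrite (cardsD1 j) jT => -[].
have := PZ ((-1) ^+ #|[set k in T | (k < j)%N]|) (PM IH (Pa j)).
set B := _ *: _; suff -> : B = delta_mx (rk finset.set0) (rk T) by [].
apply: fock_mxP => S U; rewrite mxE [X in _ * X]mxE fock_sum (bigD1 (T :\ j)) //= big1 ?addr0; last first.
  by move=> Z /negbTE h; rewrite mxE !(inj_eq enum_rank_inj) h andbF mul0r.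
rewrite annihE !mxE !(inj_eq enum_rank_inj) eqxx andbT.
case: (boolP (j \in U)) => jU /=.
  rewrite eq_setD1 // [T == U]eq_sym; case: (U =P T) => [->|_]; rewrite ?mulr0 ?andbF //.
  by rewrite mulrCA -expr2 sqrr_sign andbT mulr1.
rewrite !mulr0; case: (U =P T) => [e|]; last by rewrite andbF.
by rewrite e jT in jU.
Qed.

Lemma matrix_unit (S T : {set 'I_n}) : P (delta_mx (rk S) (rk T)).
Proof.
elim: {S}#|S| {-2}S (erefl #|S|) => [|m IH] S.
  by move/eqP; rewrite cards_eq0 => /eqP ->; apply: vacuum_row_unit.
move=> cT; have [j jT] : exists j, j \in S by apply/set0Pn; rewrite -cards_eq0 cT.
have {}IH : P (delta_mx (rk (S :\ j)) (rk T)).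
  by apply: IH; move: cT; rewrite (cardsD1 j) jT => -[].
have := PZ ((-1) ^+ #|[set k in S | (k < j)%N]|) (PM (Pc j) IH).
set B := _ *: _; suff -> : B = delta_mx (rk S) (rk T) by [].
apply: fock_mxP => U V; rewrite mxE [X in _ * X]mxE fock_sum (bigD1 (S :\ j)) //= big1 ?addr0; last first.
  by move=> Z /negbTE h; rewrite [X in _ * X]mxE !(inj_eq enum_rank_inj) h mulr0.
rewrite creatE !mxE !(inj_eq enum_rank_inj) eqxx /=.
case: (boolP (j \in U)) => jU /=.
  rewrite eq_setD1 // [S == U]eq_sym; case: (U =P S) => [->|_]; rewrite ?mulr0 ?mul0r ?mulr0 //.
  by rewrite mulrA -expr2 sqrr_sign mul1r.
rewrite mul0r !mulr0; case: (U =P S) => [e|//].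
by rewrite e jT in jU.
Qed.
End MatrixUnits.

Section ReducedState.
Variables (N : nat) (A : {set 'I_N}).
(* The modes of A contribute the set inner X, and the reordering that brings
   them before the other modes has sign jw_sign X; embed_op B is B acting on the
   modes of A, as shown by local_opE. *)
Definition inner (X : {set 'I_N}) : {set 'I_#|A|} := [set i | enum_val i \in X].
Definition glue (S : {set 'I_#|A|}) (X : {set 'I_N}) : {set 'I_N} :=
  [set enum_val i | i in S] :|: X :\: A.
Definition jw_sign (X : {set 'I_N}) : R[i] :=
  \prod_(s in X :&: A) (-1) ^+ #|[set k in X :\: A | (k < s)%N]|.
Definition embed_op (B : 'M[R[i]]_(fock_dim #|A|)) : 'M[R[i]]_(fock_dim N) :=
  \matrix_(x, y) (let X : {set 'I_N} := enum_val x in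
    let Y : {set 'I_N} := enum_val y in
    if X :\: A == Y :\: A then jw_sign X * jw_sign Y * B (rk (inner X)) (rk (inner Y)) else 0).

Lemma embed_opE B (X Y : {set 'I_N}) : embed_op B (rk X) (rk Y) =
  if X :\: A == Y :\: A then jw_sign X * jw_sign Y * B (rk (inner X)) (rk (inner Y)) else 0.
Proof. by rewrite mxE /= !enum_rankK. Qed.

Lemma jw_signK X : jw_sign X * jw_sign X = 1.
Proof.
rewrite -big_split /= big1 // => s _; rewrite -expr2 sqrr_sign //.
Qed.

Lemma inner_outer_inj (X Y : {set 'I_N}) : X :\: A = Y :\: A -> inner X = inner Y -> X = Y.
Proof.
move=> /setP h1 /setP h2; apply/setP=> j.
case: (boolP (j \in A)) => jA; last by move: (h1 j); rewrite !inE jA.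
by move: (h2 (enum_rank_in jA j)); rewrite !inE enum_rankK_in.
Qed.

Lemma glue_outer S X : glue S X :\: A = X :\: A.
Proof.
apply/setP=> j; rewrite !inE; case: (boolP (j \in A)) => //= jA.
rewrite orbC; case: (j \in X) => //=; apply/imsetP => -[i _ e].
by move: jA; rewrite e enum_valP.
Qed.

Lemma glueK S X : inner (glue S X) = S.
Proof.
apply/setP=> i; rewrite !inE enum_valP /= orbF mem_imset //.
exact: enum_val_inj.
Qed.

Lemma innerK Z : glue (inner Z) Z = Z.
Proof. by apply: inner_outer_inj; rewrite ?glue_outer ?glueK. Qed.

Lemma embed_op1 : embed_op 1%:M = 1%:M.
Proof.
apply: fock_mxP => X Y; rewrite embed_opE !mxE !(inj_eq enum_rank_inj).
case: (eqVneq X Y) => [->|nXY]; first by rewrite !eqxx jw_signK mulr1.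
case: eqP => // h1; case: eqP => h2; last by rewrite mulr0.
by move: nXY; rewrite (inner_outer_inj h1 h2) eqxx.
Qed.

Lemma embed_opD B1 B2 : embed_op (B1 + B2) = embed_op B1 + embed_op B2.
Proof.
apply: fock_mxP => X Y; rewrite [RHS]mxE !embed_opE !mxE.
by case: ifP; rewrite ?addr0 // mulrDr.
Qed.

Lemma embed_opZ c B : embed_op (c *: B) = c *: embed_op B.
Proof.
apply: fock_mxP => X Y; rewrite [RHS]mxE !embed_opE !mxE.
by case: ifP => _; rewrite ?mulr0 //; ring.
Qed.

Lemma embed_opM B1 B2 : embed_op (B1 *m B2) = embed_op B1 *m embed_op B2.
Proof.
apply: fock_mxP => X Y; rewrite embed_opE [RHS]mxE fock_sum.
under eq_bigr => Z _ do rewrite (embed_opE B1) (embed_opE B2).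
rewrite (bigID (fun Z : {set 'I_N} => Z :\: A == X :\: A)) /= [X in _ = _ + X]big1 ?addr0;
  last by move=> Z /negbTE h; rewrite eq_sym h mul0r.
case: ifP => [/eqP hXY|hXY]; last first.
  by rewrite big1 // => Z /eqP h; rewrite h hXY mulr0.
rewrite mxE fock_sum (reindex_onto (fun S => glue S X) inner) /=; last first.
  by move=> Z /eqP h; rewrite /glue -h -/(glue _ Z) innerK.
rewrite mulr_sumr; apply: eq_big => [S|S _]; first by rewrite glue_outer glueK !eqxx.
rewrite glue_outer hXY eqxx glueK.
set g := jw_sign (glue _ _).
transitivity ((g * g) * (jw_sign X * jw_sign Y * (B1 (rk (inner X)) (rk S) * B2 (rk S) (rk (inner Y))))); first by rewrite jw_signK mul1r.
set a := jw_sign X; set b := jw_sign Y; set u := B1 _ _; set v := B2 _ _.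
ring.
Qed.

Lemma enum_val_mono (i k : 'I_#|A|) : (enum_val i < enum_val k)%N = (i < k)%N.
Proof.
have st : sorted ltn [seq val x | x <- enum A].
  rewrite /enum_mem -enumT /=.
  apply: (subseq_sorted ltn_trans (s2 := [seq val x | x <- enum 'I_N])).
    by apply: map_subseq; apply: filter_subseq.
  by rewrite val_enum_ord iota_ltn_sorted.
have x0 : 'I_N by exact: (enum_val i).
have mono (a b : 'I_#|A|) : (a < b)%N -> (enum_val a < enum_val b)%N.
  move=> ab.
  rewrite !(enum_val_nth x0).
  have sz : size [seq val x | x <- enum A] = #|A| by rewrite size_map -cardE.
  have := sorted_ltn_nth ltn_trans 0%N st (a : nat) (b : nat).
  rewrite !inE sz !ltn_ord => /(_ isT isT ab).
  by rewrite !(nth_map x0) -?cardE.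
case: (ltngtP i k) => [/mono//|/mono h|/val_inj ->]; last by rewrite ltnn.
by apply/negbTE; rewrite -leqNgt ltnW.
Qed.

Lemma innerD1 Y (i : 'I_#|A|) : inner (Y :\ enum_val i) = inner Y :\ i.
Proof. by apply/setP=> k; rewrite !inE (inj_eq enum_val_inj). Qed.

Lemma outerD1 Y (i : 'I_#|A|) : (Y :\ enum_val i) :\: A = Y :\: A.
Proof.
apply/setP=> k; rewrite !inE.
by case: eqP => [->|_]; rewrite //= enum_valP.
Qed.

Lemma embed_op_annih i : embed_op (annih i) = annih (enum_val i).
Proof.
apply: fock_mxP => X Y; rewrite embed_opE !annihE inE.
case: (boolP (enum_val i \in Y)) => jY /=; last by rewrite mulr0 if_same.
case: (eqVneq X (Y :\ enum_val i)) => [->|ne]; last first.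
  case: eqP => // h1; case: eqP => h2; rewrite ?mulr0 //.
  by case/eqP: ne; apply: inner_outer_inj; rewrite ?innerD1 ?outerD1.
rewrite outerD1 innerD1 !eqxx.
have -> : jw_sign Y = (-1) ^+ #|[set k in Y :\: A | (k < enum_val i)%N]| * jw_sign (Y :\ enum_val i).
  rewrite /jw_sign (bigD1 (enum_val i)) /=; last by rewrite inE jY enum_valP.
  congr (_ * _); apply: eq_big => k; first by rewrite !inE andbC andbA.
  by rewrite outerD1.
have -> : #|[set k in Y | (k < enum_val i)%N]| =
  (#|[set k in inner Y | (k < i)%N]| + #|[set k in Y :\: A | (k < enum_val i)%N]|)%N.
  rewrite -(cardsID A [set k in Y | (k < enum_val i)%N]); congr (_ + _)%N.
    rewrite -(card_imset _ (@enum_val_inj _ (mem A))); apply: eq_card => k.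
    apply/idP/imsetP => [|[l]]; rewrite !inE.
      case/andP=> /andP[kY ki] kA; exists (enum_rank_in kA k); last by rewrite enum_rankK_in.
      by rewrite !inE -enum_val_mono enum_rankK_in // kY.
    by move=> /andP[lY li] ->; rewrite lY enum_val_mono li enum_valP.
  by apply: eq_card => k; rewrite !inE andbA.
rewrite exprD; set p := (-1) ^+ _; set e := (-1) ^+ _; set g := jw_sign _.
by rewrite -[RHS]mul1r -(jw_signK (Y :\ enum_val i)) -/g; ring.
Qed.

Lemma jw_sign_conj X : Num.conj (jw_sign X) = jw_sign X.
Proof. by rewrite rmorph_prod; apply: eq_bigr => s _; rewrite rmorph_sign. Qed.

Lemma embed_op_adj B : embed_op (B^t*) = (embed_op B)^t*.
Proof.
apply: fock_mxP => X Y. rewrite [RHS]mxE [in RHS]mxE !embed_opE eq_sym !mxE.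
case: ifP => _; last by rewrite rmorph0.
by rewrite !rmorphM /= !jw_sign_conj [jw_sign X * _]mulrC.
Qed.

Lemma local_opE B B' : local_op B B' -> B' = embed_op B.
Proof.
elim=> {B B'} [i|i||B1 B1' B2 B2' _ -> _ ->|c B B' _ ->|B1 B1' B2 B2' _ -> _ ->].
- by rewrite embed_op_annih.
- by rewrite embed_op_adj embed_op_annih.
- by rewrite embed_op1.
- by rewrite embed_opD.
- by rewrite embed_opZ.
- by rewrite embed_opM.
Qed.

Lemma reduced_exists (rho : 'M[R[i]]_(fock_dim N)) :
  exists X, is_reduced (A := A) rho X.
Proof.
exists (\matrix_(x, y) \tr (rho *m embed_op (delta_mx y x))) => B B' /local_opE ->.
rewrite [in RHS](matrix_sum_delta B).
have emb0 : embed_op 0 = 0 by have := embed_opZ 0 0; rewrite !scale0r.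
have embS (I : finType) (F : I -> 'M[R[i]]_(fock_dim #|A|)) : embed_op (\sum_x F x) = \sum_x embed_op (F x).
  by apply: (big_morph embed_op embed_opD emb0).
transitivity (\sum_y \sum_x B y x * \tr (rho *m embed_op (delta_mx y x))).
  rewrite exchange_big /= {1}/mxtrace; apply: eq_bigr => x _; rewrite mxE.
  by apply: eq_bigr => y _; rewrite mxE mulrC.
rewrite embS mulmx_sumr linear_sum /=; apply: eq_bigr => y _.
rewrite embS mulmx_sumr linear_sum /=; apply: eq_bigr => x _.
by rewrite embed_opZ -scalemxAr linearZ.
Qed.

Lemma local_delta (S T : {set 'I_#|A|}) :
  exists B', local_op (delta_mx (rk S) (rk T) : 'M[R[i]]_(fock_dim #|A|)) B'.
Proof.
apply: (@matrix_unit _ (fun B => exists B', local_op B B')) => {S T}.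
- by move=> j; exists (annih (enum_val j)); constructor.
- by move=> j; exists (creat (enum_val j)); constructor.
- by exists 1%:M; constructor.
- by move=> a b [a' ha] [b' hb]; exists (a' + b'); constructor.
- by move=> c a [a' ha]; exists (c *: a'); constructor.
- by move=> a b [a' ha] [b' hb]; exists (a' *m b'); constructor.
Qed.

Lemma reduced_unique (rho : 'M[R[i]]_(fock_dim N)) X1 X2 :
  is_reduced (A := A) rho X1 -> is_reduced rho X2 -> X1 = X2.
Proof.
move=> h1 h2; apply: fock_mxP => S T; have [B' h] := local_delta T S.
have := etrans (h1 _ _ h) (esym (h2 _ _ h)).
have E (X : 'M[R[i]]_(fock_dim #|A|)) x y : \tr (X *m delta_mx x y) = X y x.
  rewrite /mxtrace (bigD1 y) //= big1 => [|z /negbTE zy]; rewrite mxE.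
    rewrite (bigD1 x) //= big1 => [|z /negbTE zx]; rewrite mxE ?eqxx ?mulr1 ?addr0 //.
    by rewrite zx mulr0.
  by rewrite big1 // => w _; rewrite mxE zy andbF mulr0.
by rewrite !E.
Qed.

Lemma reducedP (rho : 'M[R[i]]_(fock_dim N)) : is_reduced rho (reduced A rho).
Proof.
have [X hX] := reduced_exists rho.
exact: (@xgetPex _ 0 [set Y | is_reduced rho Y]%classic (ex_intro _ X hX)).
Qed.

End ReducedState.
End WellDefined.

End Fock.

(* Main.v *)
(* Particle number is conserved, so the reduced state is block diagonal: the
   block with k particles in A has trace p_k(R) and, by the Schmidt
   decomposition, rank at most min(C(L, k), C(N - L, n - k)). Over a uniformly
   random R, p_k has the hypergeometric mean P_k because the evolution is
   unitary. By Klein's inequality with the weights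
   q_k = max(C(L, k), C(N - L, n - k)) / C(N, n), the mean entropy is at most
   - sum_k P_k ln q_k = ln C(N, n) - sum_k P_k ln max(C(L, k), C(N - L, n - k)).

   Keeping C(N - L, n - k) in the maximum leaves the entropy of the first L of
   N draws without replacement. The chain rule makes it a sum of the means of
   H_b(x_j), where x_j is the fraction of particles left after j draws. As H_b
   lies below its third-order Taylor polynomials and x_j is a martingale with
   variance j nu (1 - nu) / ((N - 1) (N - j)) and nonpositive third central
   moment for j <= N / 2, this gives H_b(nu) L + (f + ln (1 - f)) / 2 + O(1 / L)
   without Stirling's formula.

   If f = 1 / 2, the maximum is the arithmetic mean plus half the absolute
   difference of the logarithms, and the latter is at least
   |2 k - n| ln ((N - n + 1) / (n + 1)). The mean absolute deviation of k
   telescopes to a single central hypergeometric probability, a ratio of central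
   binomial coefficients, which are bounded by Wallis' product. *)

Require Import Defs.
From HB Require Import structures.
From mathcomp Require Import all_boot all_order all_algebra.
From mathcomp Require Import sesquilinear spectral complex.
From mathcomp Require Import all_classical all_reals all_analysis.
From mathcomp Require Import ring lra zify.

Set Implicit Arguments.
Unset Strict Implicit.
Unset Printing Implicit Defensive.

Import Order.TTheory GRing.Theory Num.Theory.
Local Open Scope ring_scope.

(** * Sampling without replacement *)

Section HypergeometricMean.
Variable R : realType.

(* The mean of g (number of successes left) after j draws without replacement
   from N elements, n of which are successes. *)
Definition hyp_mean (N n j : nat) (g : nat -> R) : R :=
  ('C(N, n)%:R)^-1 * \sum_(m < n.+1) ('C(j, n - m) * 'C(N - j, m))%:R * g m.

Lemma eq_hyp_mean N n j g1 g2 :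
  (forall m, (m <= n)%N -> (m <= N - j)%N -> g1 m = g2 m) ->
  hyp_mean N n j g1 = hyp_mean N n j g2.
Proof.
move=> e; congr (_ * _); apply: eq_bigr => m _.
case: (leqP m (N - j)) => h; first by rewrite e // -ltnS.
by rewrite [X in (_ * X)%N]bin_small // muln0 !mul0r.
Qed.

(** Outcomes with [m > N - j] have weight 0. Restricting the comparison to the others is what later
    keeps [left_frac R (N - j) m] inside [0, 1]. *)
Lemma le_hyp_mean N n j g1 g2 :
  (forall m, (m <= n)%N -> (m <= N - j)%N -> g1 m <= g2 m) ->
  hyp_mean N n j g1 <= hyp_mean N n j g2.
Proof.
move=> e; apply: ler_wpM2l; first by rewrite invr_ge0 ler0n.
apply: ler_sum => m _.
case: (leqP m (N - j)) => h.
  by apply: ler_wpM2l => //; apply: e => //; rewrite -ltnS.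
by rewrite [X in (_ * X)%N]bin_small // muln0 !mul0r.
Qed.

Lemma hyp_meanD N n j g1 g2 :
  hyp_mean N n j (fun m => g1 m + g2 m) = hyp_mean N n j g1 + hyp_mean N n j g2.
Proof.
rewrite /hyp_mean -mulrDr -big_split /=; congr (_ * _).
by apply: eq_bigr => m _; rewrite mulrDr.
Qed.

Lemma hyp_meanZ N n j c g :
  hyp_mean N n j (fun m => c * g m) = c * hyp_mean N n j g.
Proof.
rewrite /hyp_mean mulrCA; congr (_ * _); rewrite mulr_sumr.
by apply: eq_bigr => m _; rewrite mulrCA.
Qed.

Lemma hyp_mean0 N n g : (n <= N)%N -> hyp_mean N n 0 g = g n.
Proof.
move=> nN; rewrite /hyp_mean big_ord_recr /= big1 ?add0r.
  by rewrite subn0 subnn bin0 mul1n mulrA mulVf ?mul1r // pnatr_eq0 -lt0n bin_gt0.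
by move=> m _; rewrite bin0n subn_eq0 leqNgt ltn_ord mul0n mul0r.
Qed.

(* Passing from j to j + 1 draws one more element, which is a success with
   probability m / (N - j) when m successes are left among the N - j others. *)
Lemma hyp_meanS N n j g : (j < N)%N ->
  hyp_mean N n j.+1 g = hyp_mean N n j (fun m =>
    (1 - m%:R / (N - j)%:R) * g m + m%:R / (N - j)%:R * g m.-1).
Proof.
move=> jN; congr (_ * _).
have eM : (N - j = (N - j.+1).+1)%N by lia.
rewrite eM; set M := (N - j.+1)%N.
have M0 : M.+1%:R != 0 :> R by rewrite pnatr_eq0.
(* Pascal's rule for C(j + 1, n - m): in the first sum the last draw is a failure, in the second a
   success. *)
transitivity (\sum_(m < n.+1) ('C(j, n - m) * 'C(M, m))%:R * g m +
              \sum_(m < n) ('C(j, n - m.+1) * 'C(M, m))%:R * g m).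
  rewrite !big_ord_recr /= subnn !bin0 addrAC -big_split /=.
  congr (_ + _); apply: eq_bigr => m _.
  have -> : (n - m = (n - m.+1).+1)%N by have := ltn_ord m; lia.
  by rewrite binS mulnDl natrD mulrDl.
(* Shifting the index so that [m] counts the successes left before the draw; m C(M + 1, m) = (M + 1)
   C(M, m - 1) then produces the success probability. *)
have -> : \sum_(m < n) ('C(j, n - m.+1) * 'C(M, m))%:R * g m =
    \sum_(m < n.+1) ('C(j, n - m) * 'C(M.+1, m))%:R * (m%:R / M.+1%:R * g m.-1).
  rewrite [RHS]big_ord_recl /= mul0r mul0r mulr0 add0r; apply: eq_bigr => m _.
  rewrite /bump /= add1n /=.
  have := mul_bin_diag M.+1 m; rewrite /= => /(congr1 (fun k => k%:R : R)).
  rewrite !natrM => e.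
  have -> : 'C(M, m)%:R = m.+1%:R * 'C(M.+1, m.+1)%:R / M.+1%:R :> R.
    by rewrite -e mulrC mulrA mulVf ?mul1r.
  by rewrite !mulrA; congr (_ * _); rewrite -!mulrA; congr (_ * _); ring.
rewrite -big_split /=; apply: eq_bigr => m _.
rewrite mulrDr; congr (_ + _).
have := mul_bin_down M.+1 m; rewrite /=.
case: (leqP m M.+1) => mM.
  move=> /(congr1 (fun k => k%:R : R)); rewrite !natrM natrB // => e.
  have -> : 'C(M, m)%:R = (M.+1%:R - m%:R) * 'C(M.+1, m)%:R / M.+1%:R :> R.
    by rewrite -e mulrC mulrA mulVf ?mul1r.
  by field; rewrite nat1r pnatr_eq0.
by move=> _; rewrite !['C(_, m)]bin_small ?muln0 ?mul0r //; lia.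
Qed.

(** The weights sum to 1: Vandermonde's identity, read off the one-step recursion. *)
Lemma hyp_mean_cst N n j c : (n <= N)%N -> (j <= N)%N ->
  hyp_mean N n j (fun=> c) = c.
Proof.
move=> nN; elim: j => [|j IH] jN; first by rewrite hyp_mean0.
rewrite hyp_meanS // -[RHS](IH (ltnW jN)); apply: eq_hyp_mean => m _ _; ring.
Qed.

(* The fraction of successes among the elements not yet drawn. *)
Definition left_frac (M m : nat) : R := m%:R / M%:R.

(** Martingale property: one more draw preserves the conditional mean of the fraction left. *)
Lemma hyp_mean1 N n j : (n <= N)%N -> (j < N)%N ->
  hyp_mean N n j (left_frac (N - j)) = left_frac N n.
Proof.
move=> nN; elim: j => [|j IH] jN; first by rewrite hyp_mean0 // subn0.
rewrite hyp_meanS; last by lia.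
rewrite -[RHS]IH; last by lia.
apply: eq_hyp_mean => m _ _; rewrite /left_frac.
have -> : (N - j = (N - j.+1).+1)%N by lia.
have : (0 < N - j.+1)%N by lia.
set M := (N - j.+1)%N => M0.
have M1 : M%:R != 0 :> R by rewrite pnatr_eq0; lia.
have M2 : 1 + M%:R != 0 :> R by rewrite nat1r pnatr_eq0.
case: m => [|m]; rewrite /= -?nat1r; field; by rewrite ?M1 ?M2.
Qed.

End HypergeometricMean.

(** * Central moments of the fraction left *)

Section Moments.
Variable R : realType.

Lemma hyp_mean_left N n j : (n <= N)%N -> (j < N)%N ->
  hyp_mean N n j (fun m => left_frac R (N - j) m - left_frac R N n) = 0.
Proof.
move=> nN jN; have := hyp_mean1 R nN jN; set a := left_frac R N n => h.
have -> : hyp_mean N n j (fun m => left_frac R (N - j) m - a) =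
  hyp_mean N n j (left_frac R (N - j)) + hyp_mean N n j (fun=> - a) by rewrite -hyp_meanD.
by rewrite h hyp_mean_cst ?subrr // ltnW.
Qed.

(** Induction on [j]. If the fraction is now x = a + y, one draw adds the conditional variance D^2 x
    (1 - x) with D = 1 / (N - j - 1). In its expansion in powers of y the linear term has mean 0. *)
Lemma hyp_mean_left2 N n j : (n <= N)%N -> (j.+1 < N)%N ->
  hyp_mean N n j (fun m => (left_frac R (N - j) m - left_frac R N n) ^+ 2) =
  j%:R * left_frac R N n * (1 - left_frac R N n) / ((N%:R - 1) * (N%:R - j%:R)).
Proof.
move=> nN; elim: j => [|j IH] jN.
  by rewrite hyp_mean0 // subn0 subrr expr0n /= !mul0r.
have nu1 := hyp_mean_left nN (ltn_trans (leqnSn j.+1) jN).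
have {}IH := IH (ltnW jN).
rewrite hyp_meanS; last by lia.
move: nu1 IH; set a := left_frac R N n => nu1 IH.
pose D : R := (N%:R - j%:R - 1)^-1.
have D0 : N%:R - j%:R - 1 != 0 :> R.
  by rewrite -addrA -opprD natr1 -natrB 1?pnatr_eq0; lia.
have D1 : N%:R - j%:R != 0 :> R by rewrite -natrB 1?pnatr_eq0; lia.
have D2 : N%:R - 1 != 0 :> R by rewrite -[1]/(1%:R) -natrB 1?pnatr_eq0; lia.
transitivity (hyp_mean N n j (fun m =>
   (1 - D ^+ 2) * (left_frac R (N - j) m - a) ^+ 2 +
   (((1 - 2 * a) * D ^+ 2) * (left_frac R (N - j) m - a) + a * (1 - a) * D ^+ 2))).
  apply: eq_hyp_mean => m _ _; rewrite /left_frac -/a /D.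
  have -> : (N - j)%:R = N%:R - j%:R :> R by rewrite natrB //; lia.
  have -> : (N - j.+1)%:R = N%:R - j%:R - 1 :> R by rewrite natrB; [rewrite -natr1; ring|lia].
  by case: m => [|m]; rewrite /= -?nat1r; field; rewrite ?D0 ?D1.
rewrite !hyp_meanD !hyp_meanZ nu1 mulr0 add0r IH hyp_mean_cst //; last by lia.
rewrite /D -natr1 opprD addrA; field; by rewrite D0 D1 D2.
Qed.

(** The same recursion, now with the conditional third moment - D^3 x (1 - x) (1 - 2 x) of a single
    draw. The factors 1 - 2 a and N - 2 j show the sign when both ratios are at most one half. *)
Lemma hyp_mean_left3 N n j : (n <= N)%N -> (j.+1 < N)%N -> (2 < N)%N ->
  hyp_mean N n j (fun m => (left_frac R (N - j) m - left_frac R N n) ^+ 3) =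
  - (j%:R * left_frac R N n * (1 - left_frac R N n) * (1 - 2 * left_frac R N n) * (N%:R - 2 * j%:R)
   / ((N%:R - 1) * (N%:R - 2) * (N%:R - j%:R) ^+ 2)).
Proof.
move=> nN + N2; elim: j => [|j IH] jN.
  by rewrite hyp_mean0 // subn0 subrr expr0n /= !mul0r oppr0.
have nu1 := hyp_mean_left nN (ltn_trans (leqnSn j.+1) jN).
have nu2 := hyp_mean_left2 nN (ltnW jN).
have {}IH := IH (ltnW jN).
rewrite hyp_meanS; last by lia.
move: nu1 nu2 IH; set a := left_frac R N n => nu1 nu2 IH.
pose D : R := (N%:R - j%:R - 1)^-1.
have D0 : N%:R - j%:R - 1 != 0 :> R.
  by rewrite -addrA -opprD natr1 -natrB 1?pnatr_eq0; lia.
have D1 : N%:R - j%:R != 0 :> R by rewrite -natrB 1?pnatr_eq0; lia.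
have D2 : N%:R - 1 != 0 :> R by rewrite -[1]/(1%:R) -natrB 1?pnatr_eq0; lia.
have D3 : N%:R - 2 != 0 :> R by rewrite -natrB 1?pnatr_eq0; lia.
transitivity (hyp_mean N n j (fun m =>
   (1 - 3 * D ^+ 2 - 2 * D ^+ 3) * (left_frac R (N - j) m - a) ^+ 3 +
   ((3 * (1 - 2 * a) * (D ^+ 2 + D ^+ 3)) * (left_frac R (N - j) m - a) ^+ 2 +
   ((3 * a * (1 - a) * D ^+ 2 - D ^+ 3 * (1 - 6 * a + 6 * a ^+ 2)) * (left_frac R (N - j) m - a)
    - a * (1 - a) * (1 - 2 * a) * D ^+ 3)))).
  apply: eq_hyp_mean => m _ _; rewrite /left_frac -/a /D.
  have -> : (N - j)%:R = N%:R - j%:R :> R by rewrite natrB //; lia.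
  have -> : (N - j.+1)%:R = N%:R - j%:R - 1 :> R by rewrite natrB; [rewrite -natr1; ring|lia].
  by case: m => [|m]; rewrite /= -?nat1r; field; rewrite ?D0 ?D1.
rewrite !hyp_meanD !hyp_meanZ nu1 nu2 mulr0 add0r IH hyp_mean_cst //; last by lia.
rewrite /D -[j.+1%:R]natr1.
have -> : N%:R - (j%:R + 1) = N%:R - j%:R - 1 :> R by ring.
field; by rewrite D1 D2 D3 /= D0.
Qed.
End Moments.

(** * Taylor bound for the entropy and Wallis' product *)

Section RealAnalysis.
Variable R : realType.
Import numFieldNormedType.Exports.
Implicit Types (f df : R -> R) (a b x : R).

Lemma is_derive_ge0_le f df a b : a <= b ->
  (forall x, a <= x <= b -> is_derive x (1 : R) f (df x)) ->
  (forall x, a <= x <= b -> 0 <= df x) -> f a <= f b.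
Proof.
rewrite le_eqVlt => /predU1P[->//|ab] fd df0.
have [||c /[!in_itv]/= /andP[/ltW ac /ltW cb]] := @MVT R f df a b ab.
- by move=> x /[!in_itv]/= /andP[/ltW ax /ltW xb]; apply: fd; rewrite ax.
- apply: derivable_within_continuous => x /[!in_itv]/= /fd [].
  by [].
move=> e; rewrite -subr_ge0 e mulr_ge0 ?subr_ge0 ?(ltW ab) //.
by apply: df0; rewrite ac.
Qed.

(** Third-order Taylor polynomial of x ln x at 1. After division by x the difference of the two
    sides has derivative (x - 1)^3 / (3 x^2), so it is minimal at 1, where it vanishes. *)
Lemma ln_ge_cubic x : 0 < x ->
  (x - 1) + (x - 1) ^+ 2 / 2 - (x - 1) ^+ 3 / 6 <= x * ln x.
Proof.
move=> x0.
pose psi u : R := ln u - ((u - 1) + (u - 1) ^+ 2 / 2 - (u - 1) ^+ 3 / 6) * u^-1.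
pose dpsi u : R := (u - 1) ^+ 3 / (3 * u ^+ 2).
have d (u : R) : 0 < u -> is_derive u (1 : R) psi (dpsi u).
  move=> u0; have lnu := is_derive1_ln u0.
  have uV : is_derive u (1 : R) (fun y => y^-1 : R) (- u ^- 2 *: (1 : R)).
    by apply: is_deriveV; rewrite gt_eqF.
  rewrite /psi; apply: is_derive_eq.
  rewrite /dpsi /GRing.scale /=; field; rewrite gt_eqF //.
suff : 0 <= psi x.
  rewrite /psi subr_ge0 => /(ler_wpM2l (ltW x0)); apply: le_trans.
  by rewrite mulrCA mulfV ?mulr1 // gt_eqF.
have -> : 0 = psi 1 by rewrite /psi ln1 subrr !expr0n /=; ring.
have [x1|x1] := leP 1 x.
  apply: (@is_derive_ge0_le psi dpsi 1 x x1) => u /andP[u1 ux].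
    by apply: d; apply: lt_le_trans u1.
  by apply: divr_ge0; rewrite ?exprn_ge0 ?subr_ge0 // mulr_ge0 ?exprn_ge0 // (le_trans _ u1).
rewrite -lerN2.
have := @is_derive_ge0_le (fun u => - psi u) (fun u => - dpsi u) x 1 (ltW x1).
apply.
  move=> u /andP[xu u1]; have := d u (lt_le_trans x0 xu) => ?.
  exact: is_deriveN.
move=> u /andP[xu u1]; rewrite /dpsi -mulNr divr_ge0 //; last first.
  by apply: mulr_ge0 => //; apply/exprn_ge0/ltW/(lt_le_trans x0 xu).
have : 0 <= (1 - u) ^+ 3 by rewrite exprn_ge0 // subr_ge0.
by congr (_ <= _); ring.
Qed.

(** [ln_ge_cubic] at [x / a], scaled by [a]. *)
Lemma xlnx_taylor a x : 0 < a -> 0 <= x ->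
  - x * ln x <= - a * ln a - (ln a + 1) * (x - a) - (x - a) ^+ 2 / (2 * a)
    + (x - a) ^+ 3 / (6 * a ^+ 2).
Proof.
move=> a0; rewrite le_eqVlt => /predU1P[<-|x0].
  (* At x = 0 the left side is 0 and the right side equals a / 3. *)
  rewrite ln0 // mulr0 -subr_ge0.
  have : 0 <= a / 3 by rewrite divr_ge0 // ltW.
  by congr (_ <= _); field; rewrite gt_eqF.
have xa : 0 < x / a by rewrite divr_gt0.
have := ln_ge_cubic xa; rewrite lnM ?posrE ?invr_gt0 // lnV ?posrE //.
move=> /(ler_wpM2l (ltW a0)); rewrite -lerN2 => h.
have -> : - x * ln x = - (a * (x / a * (ln x - ln a))) - x * ln a.
  by field; rewrite gt_eqF.
rewrite -lerBrDr opprK; apply: le_trans h _; rewrite le_eqVlt; apply/orP; left; apply/eqP.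
by field; rewrite gt_eqF.
Qed.

(** Sum of [xlnx_taylor] for x around a and for 1 - x around 1 - a. *)
Lemma binary_entropy_taylor a x : 0 < a < 1 -> 0 <= x <= 1 ->
  binary_entropy x <= binary_entropy a + ln ((1 - a) / a) * (x - a)
    - (x - a) ^+ 2 / (2 * a * (1 - a))
    + (1 - 2 * a) / (6 * (a * (1 - a)) ^+ 2) * (x - a) ^+ 3.
Proof.
move=> /andP[a0 a1] /andP[x0 x1].
have h0 := xlnx_taylor a0 x0.
have a1' : 0 < 1 - a by rewrite subr_gt0.
have h1 := xlnx_taylor a1' (_ : 0 <= 1 - x); rewrite subr_ge0 in h1.
have := lerD h0 (h1 x1).
rewrite /binary_entropy !mulNr => h; apply: le_trans h _.
rewrite lnM ?posrE ?invr_gt0 // lnV ?posrE //.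
rewrite le_eqVlt; apply/orP; left; apply/eqP.
by field; rewrite !gt_eqF.
Qed.

(* Antiderivatives of the powers of the cosine, by the reduction formula. *)
Fixpoint cosint (m : nat) (x : R) : R :=
  match m with
  | 0 => x
  | 1 => sin x
  | (m'.+1 as p).+1 =>
      cos x ^+ p * sin x / p.+1%:R + p%:R / p.+1%:R * cosint m' x
  end.

Lemma is_derive_cosint m x : is_derive x (1 : R) (cosint m) (cos x ^+ m).
Proof.
elim/ltn_ind: m => -[|[|m]] IH.
- rewrite expr0 /=; exact: is_derive_id.
- by rewrite expr1 /=; exact: is_derive_sin.
have IHm := IH m (leqnSn _).
have dc := is_derive_cos x; have ds := is_derive_sin x.
have -> : cosint m.+2 = m.+2%:R^-1 *: (cos ^+ m.+1 * sin) + (m.+1%:R / m.+2%:R) *: cosint m.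
  apply/funext => y; rewrite /= !fctE /GRing.scale /=.
  by rewrite mulrC.
apply: is_derive_eq; rewrite !fctE /GRing.scale /= !exprS -natr1 -[m.+1%:R]natr1.
have := cos2Dsin2 x; set c := cos x; set s := sin x => /eqP.
rewrite addrC eq_sym -subr_eq => /eqP s2.
have -> : s * ((m%:R + 1) * c ^+ m * - s) = - (m%:R + 1) * c ^+ m * s ^+ 2 by ring.
rewrite -s2; field; by rewrite !natr1 pnatr_eq0.
Qed.

Lemma cosint0 m : cosint m 0 = 0.
Proof.
elim/ltn_ind: m => -[|[|m]] IH //=; first exact: sin0.
by rewrite sin0 IH // mulr0 mul0r mulr0 addr0.
Qed.

(** The integral of cos^m over [0, pi / 2], since [cosint m] vanishes at 0. *)
Definition wallis (m : nat) : R := cosint m (pi / 2).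

Lemma wallis0 : wallis 0 = pi / 2. Proof. by []. Qed.

Lemma wallis1 : wallis 1 = 1. Proof. exact: sin_pihalf. Qed.

Lemma wallisSS m : wallis m.+2 = m.+1%:R / m.+2%:R * wallis m.
Proof. by rewrite /wallis /= cos_pihalf exprS !mul0r add0r. Qed.

Lemma wallis_le m : wallis m.+1 <= wallis m.
Proof.
rewrite -subr_ge0.
have -> : 0 = cosint m 0 - cosint m.+1 0 by rewrite !cosint0 subrr.
have p0 : 0 <= pi / 2 :> R by rewrite divr_ge0 // pi_ge0.
have := @is_derive_ge0_le (cosint m - cosint m.+1) (fun x => cos x ^+ m - cos x ^+ m.+1) 0 (pi/2) p0.
apply=> x /andP[x0 x1].
  have d0 := is_derive_cosint m x; have d1 := is_derive_cosint m.+1 x.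
  exact: is_deriveB.
have c0 : 0 <= cos x by rewrite cos_ge0_pihalf // x1 andbT (le_trans _ x0) // oppr_le0.
rewrite subr_ge0 exprS -[leRHS]mul1r ler_wpM2r ?exprn_ge0 // cos_le1 //.
Qed.

(* The probability of a tie after 2 m fair coin tosses. *)
Definition cbin (m : nat) : R := 'C(m.*2, m)%:R / 4 ^+ m.

Lemma cbinS m : cbin m.+1 = m.*2.+1%:R / m.*2.+2%:R * cbin m.
Proof.
have e : (m.+1 * 'C(m.+1.*2, m.+1) = 2 * m.*2.+1 * 'C(m.*2, m))%N.
  rewrite doubleS -mul_bin_diag /=.
  have := mul_bin_diag m.*2.+1 m; rewrite /= => e1.
  have e2 : 'C(m.*2.+1, m) = 'C(m.*2.+1, m.+1).
    by rewrite -bin_sub; [congr 'C(_, _)|]; lia.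
  by rewrite e2 -mulnA e1; lia.
have := congr1 (fun k => k%:R : R) e; rewrite /= !natrM /cbin => {}e.
have m0 : m.+1%:R != 0 :> R by rewrite pnatr_eq0.
have -> : 'C(m.+1.*2, m.+1)%:R = 2 * m.*2.+1%:R * 'C(m.*2, m)%:R / m.+1%:R :> R.
  by rewrite -e mulrC mulKf.
have -> : m.*2.+2%:R = 2 * m.+1%:R :> R by rewrite -natrM mul2n.
have f0 : 4 ^+ m != 0 :> R by rewrite expf_neq0 // pnatr_eq0.
by rewrite exprS; field; rewrite f0 nat1r m0.
Qed.

Lemma cbin_gt0 m : 0 < cbin m.
Proof.
by rewrite divr_gt0 ?exprn_gt0 // ltr0n bin_gt0 -addnn leq_addr.
Qed.

(** The recursion [wallisSS] makes the even integrals proportional to [cbin] and the odd ones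
    inversely proportional to it. *)
Lemma wallis_cbin m : wallis m.*2 = pi / 2 * cbin m /\
  wallis m.*2.+1 * cbin m = m.*2.+1%:R^-1.
Proof.
elim: m => [|m [IH1 IH2]].
  by rewrite wallis0 wallis1 /cbin double0 bin0 expr0 divr1 invr1 !mulr1.
have a0 : m.*2.+1%:R != 0 :> R by rewrite pnatr_eq0.
have b0 : m.*2.+2%:R != 0 :> R by rewrite pnatr_eq0.
have c0 : m.*2.+3%:R != 0 :> R by rewrite pnatr_eq0.
rewrite doubleS !wallisSS IH1 cbinS; split; first by rewrite mulrCA.
rewrite mulrACA IH2; move: a0 b0 c0.
by set a := m.*2.+1%:R; set b := m.*2.+2%:R; set c := _%:R => *; field; apply/and3P.
Qed.

(* W_2m^2 >= W_2m W_2m+1 for Wallis' integrals W. *)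
Lemma cbin_lower m : 1 <= pi * (m%:R + 1 / 2) * cbin m ^+ 2.
Proof.
have [h1 h2] := wallis_cbin m.
have := wallis_le m.*2.
have c0 := cbin_gt0 m.
move=> /(ler_wpM2r (ltW c0)); rewrite h2 h1.
have a0 : 0 < m.*2.+1%:R :> R by rewrite ltr0n.
move=> /(ler_wpM2l (ltW a0)); rewrite mulfV ?gt_eqF // => h.
apply: le_trans h _; rewrite le_eqVlt; apply/orP; left; apply/eqP.
by rewrite -natr1 -muln2 natrM; field.
Qed.

(** One step amounts to (2 k + 1) (2 k + 3) <= (2 k + 2)^2. *)
Lemma cbin_antitone m k : (m <= k)%N ->
  (k%:R + 1 / 2) * cbin k ^+ 2 <= (m%:R + 1 / 2) * cbin m ^+ 2.
Proof.
elim: k => [|k IH]; first by case: m.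
rewrite leq_eqVlt => /predU1P[->//|mk]; apply: le_trans (IH mk).
rewrite cbinS exprMn mulrA; apply: ler_wpM2r; first by rewrite exprn_ge0 // ltW // cbin_gt0.
have -> : k.*2.+1%:R = 2 * k%:R + 1 :> R by rewrite -natr1 -mul2n natrM.
have -> : k.*2.+2%:R = 2 * k%:R + 2 :> R by rewrite -addn2 natrD -mul2n natrM.
have : 0 <= k%:R :> R by rewrite ler0n.
rewrite -natr1; set x := k%:R => x0.
rewrite expr_div_n mulrA ler_pdivrMr ?exprn_gt0 //; last lra.
rewrite -subr_ge0.
have : 0 <= x + 1 / 2 by lra.
by congr (_ <= _); field.
Qed.

End RealAnalysis.

(** * Chain rule *)

Section Chain.
Variable R : realType.

Definition lnbin (M m : nat) : R := ln 'C(M, m)%:R.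

(* Chain rule for the entropy of the occupation pattern of the first draws. *)
Lemma hyp_mean_lnbin N n j : (n <= N)%N -> (j < N)%N ->
  hyp_mean N n j (lnbin (N - j)) =
  hyp_mean N n j.+1 (lnbin (N - j.+1)) +
  hyp_mean N n j (fun m => binary_entropy (left_frac R (N - j) m)).
Proof.
move=> nN jN; rewrite hyp_meanS // -hyp_meanD.
apply: eq_hyp_mean => m _ mM.
move: mM; have -> : (N - j = (N - j.+1).+1)%N by lia.
set M := (N - j.+1)%N => mM; rewrite /lnbin /binary_entropy /left_frac.
have M0 : M.+1%:R != 0 :> R by rewrite pnatr_eq0.
have M1 : 0 < M.+1%:R :> R by rewrite ltr0n.
have B0 : 0 < 'C(M.+1, m)%:R :> R by rewrite ltr0n bin_gt0.
have part1 : (1 - m%:R / M.+1%:R) * ln 'C(M, m)%:R =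
    (1 - m%:R / M.+1%:R) * (ln 'C(M.+1, m)%:R + ln (1 - m%:R / M.+1%:R)) :> R.
  (* If no failure is left (m = M + 1), the probability in front vanishes and hides the value of
     [ln] at 0; likewise for m = 0 below. *)
  move: mM; rewrite leq_eqVlt => /predU1P[->|mM]; first by rewrite divff // subrr !mul0r.
  have p0 : 0 < 1 - m%:R / M.+1%:R :> R by rewrite subr_gt0 ltr_pdivrMr // mul1r ltr_nat.
  rewrite -lnM ?posrE //; congr (_ * @ln R _).
  have := mul_bin_down M.+1 m => /(congr1 (fun k => k%:R : R)).
  rewrite /= !natrM natrB ?(ltnW mM) // => e.
  by apply: (mulfI M0); rewrite e; field; rewrite nat1r.
have part2 : m%:R / M.+1%:R * ln 'C(M, m.-1)%:R =
    m%:R / M.+1%:R * (ln 'C(M.+1, m)%:R + ln (m%:R / M.+1%:R)) :> R.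
  case: m mM B0 {part1} => [|m] mM B0; first by rewrite !mul0r.
  have q0 : 0 < m.+1%:R / M.+1%:R :> R by rewrite divr_gt0 ?ltr0n.
  rewrite -lnM ?posrE //.
  congr (_ * @ln R _).
  have := mul_bin_diag M.+1 m => /(congr1 (fun k => k%:R : R)).
  rewrite /= !natrM => e.
  by apply: (mulfI M0); rewrite e; field; rewrite nat1r.
rewrite part1 part2; ring.
Qed.

(** Mean of the Taylor bound at a = n / N: the linear term vanishes, in the quadratic one the
    variance cancels the factor a (1 - a), and the cubic one is nonpositive. *)
Lemma hyp_mean_entropy N n j : (0 < n)%N -> (n.*2 <= N)%N -> (j.*2 <= N)%N -> (2 < N)%N ->
  hyp_mean N n j (fun m => binary_entropy (left_frac R (N - j) m)) <=
  binary_entropy (left_frac R N n) - j%:R / (2 * ((N%:R - 1) * (N%:R - j%:R))).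
Proof.
move=> n0 n2 j2 N2; set a := left_frac R N n.
have N0 : 0 < N%:R :> R by rewrite ltr0n; lia.
have a0 : 0 < a by rewrite divr_gt0 // ltr0n.
have a2 : 2 * a <= 1.
  by rewrite mulrA ler_pdivrMr // mul1r -natrM ler_nat mul2n.
have a1 : 0 < 1 - a by lra.
have D1 : 0 < N%:R - j%:R :> R by rewrite -natrB ?ltr0n; lia.
have D2 : 0 < N%:R - 1 :> R by rewrite -[1]/(1%:R) -natrB ?ltr0n; lia.
have D3 : 0 < N%:R - 2 :> R by rewrite -natrB ?ltr0n; lia.
have D4 : 0 <= N%:R - 2 * j%:R :> R by rewrite -natrM -natrB ?ler0n //; lia.
apply: (@le_trans _ _ (hyp_mean N n j (fun m =>
  binary_entropy a + (ln ((1 - a) / a) * (left_frac R (N - j) m - a)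
   + ((- (2 * a * (1 - a))^-1) * (left_frac R (N - j) m - a) ^+ 2
   + (1 - 2 * a) / (6 * (a * (1 - a)) ^+ 2) * (left_frac R (N - j) m - a) ^+ 3))))).
  apply: le_hyp_mean => m mn mM.
  have h : 0 <= left_frac R (N - j) m <= 1.
    rewrite divr_ge0 //= ler_pdivrMr ?ltr0n; last by lia.
    by rewrite mul1r ler_nat.
  have ha : 0 < a < 1 by rewrite a0 /=; lra.
  apply: le_trans (binary_entropy_taylor ha h) _.
  by rewrite le_eqVlt; apply/orP; left; apply/eqP; ring.
move: (binary_entropy a) => Ha.
rewrite !hyp_meanD !hyp_meanZ hyp_mean_cst; [|lia|lia].
rewrite hyp_mean_left ?hyp_mean_left2 ?hyp_mean_left3; [|lia..].
rewrite mulr0 add0r -/a lerD2l -[leRHS]addr0; apply: lerD.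
  by rewrite le_eqVlt; apply/orP; left; apply/eqP; field; rewrite !gt_eqF.
rewrite mulrN oppr_le0; apply: mulr_ge0.
  by apply: divr_ge0; rewrite ?subr_ge0 // mulr_ge0 // exprn_ge0 // mulr_ge0 // ltW.
apply: divr_ge0; last by rewrite !mulr_ge0 ?exprn_ge0 // ltW.
have a3 : 0 <= 1 - 2 * a by rewrite subr_ge0.
by rewrite !mulr_ge0 // ltW.
Qed.

Lemma lnbin_hyp_mean_le N n L : (0 < n)%N -> (n.*2 <= N)%N -> (L.*2 <= N)%N -> (2 < N)%N ->
  lnbin N n - hyp_mean N n L (lnbin (N - L)) <=
  \sum_(j < L) (binary_entropy (left_frac R N n)
                - j%:R / (2 * ((N%:R - 1) * (N%:R - j%:R)))).
Proof.
move=> n0 n2 + N2; elim: L => [|L IH] L2.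
  by rewrite big_ord0 hyp_mean0 ?subn0 ?subrr //; lia.
rewrite big_ord_recr /=.
have -> : hyp_mean N n L.+1 (lnbin (N - L.+1)) = hyp_mean N n L (lnbin (N - L))
    - hyp_mean N n L (fun m => binary_entropy (left_frac R (N - L) m)).
  by rewrite (@hyp_mean_lnbin N n L) ?addrK //; lia.
rewrite opprB addrCA addrC; apply: lerD; last by apply: hyp_mean_entropy; lia.
by rewrite IH //; lia.
Qed.

(** Each step uses ln (1 + 1 / M) <= 1 / M, whereas the sum contains 1 / (M + 1); the excesses 1 / M
    - 1 / (M + 1) telescope to the correction. *)
Lemma sum_inv_ge N L : (L < N)%N ->
  ln N%:R - ln (N - L)%:R - ((N - L)%:R^-1 - N%:R^-1) <=
  \sum_(j < L) (N%:R - j%:R)^-1 :> R.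
Proof.
elim: L => [|L IH] LN; first by rewrite big_ord0 subn0 !subrr.
rewrite big_ord_recr /=.
have := IH (ltnW LN); rewrite -[in X in _ -> X]natrB; last by lia.
have -> : (N - L = (N - L.+1).+1)%N by lia.
have : (0 < N - L.+1)%N by lia.
set M := (N - L.+1)%N => M0 h.
have M0' : 0 < M%:R :> R by rewrite ltr0n.
have M1' : 0 < M.+1%:R :> R by rewrite ltr0n.
have : ln (M.+1%:R / M%:R) <= M%:R^-1 :> R.
  have := @le_ln1Dx R M%:R^-1.
  have -> : 1 + M%:R^-1 = M.+1%:R / M%:R :> R.
    by rewrite -natr1; field; rewrite gt_eqF.
  by apply; rewrite (lt_trans (ltrN10 R)) // invr_gt0.
rewrite lnM ?posrE ?invr_gt0 // lnV ?posrE //.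
move: h; set u := M%:R^-1; set v := M.+1%:R^-1; set S := \sum_(_ < _) _.
lra.
Qed.

Lemma page_generic (nu f : R) (N n L : nat) : (0 < n)%N -> (n.*2 <= N)%N ->
  (0 < L)%N -> (L.*2 <= N)%N -> (2 < N)%N -> n%:R = nu * N%:R -> L%:R = f * N%:R ->
  lnbin N n - hyp_mean N n L (lnbin (N - L)) <=
  binary_entropy nu * L%:R + (f + ln (1 - f)) / 2 + (2 * L%:R)^-1.
Proof.
move=> n0 n2 L0 L2 N2 en eL.
have N0 : 0 < N%:R :> R by rewrite ltr0n; lia.
have NL0 : 0 < (N - L)%:R :> R by rewrite ltr0n; lia.
have L0' : 0 < L%:R :> R by rewrite ltr0n.
have ef : f = L%:R / N%:R by rewrite eL mulfK // gt_eqF.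
apply: le_trans (lnbin_hyp_mean_le n0 n2 L2 N2) _.
have -> : left_frac R N n = nu by rewrite /left_frac en mulfK // gt_eqF.
move: (binary_entropy nu) => Ha.
rewrite big_split /= sumr_const card_ord -[Ha *+ L]mulr_natr -[leRHS]addrA lerD2l.
have {}h : ln N%:R - ln (N - L)%:R - ((N - L)%:R^-1 - N%:R^-1) <=
  \sum_(j < L) (N%:R - j%:R)^-1 :> R by apply: sum_inv_ge; lia.
have hln : ln (1 - f) = ln (N - L)%:R - ln N%:R.
  rewrite -ln_div ?posrE //; congr ln; rewrite ef natrB; last by lia.
  by field; rewrite gt_eqF.
(* Replacing N - 1 by N turns j / (N (N - j)) into 1 / (N - j) - 1 / N. *)
have hs : \sum_(j < L) - (j%:R / (2 * ((N%:R - 1) * (N%:R - j%:R)))) <=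
   - (1 / 2) * (\sum_(j < L) (N%:R - j%:R)^-1 - f).
  have -> : f = \sum_(j < L) N%:R^-1 by rewrite sumr_const card_ord -[RHS]mulr_natl ef.
  rewrite -sumrB mulr_sumr; apply: ler_sum => j _.
  have jL := ltn_ord j.
  have D1 : 0 < N%:R - j%:R :> R by rewrite -natrB ?ltr0n; lia.
  have D2 : 0 < N%:R - 1 :> R by rewrite -[1]/(1%:R) -natrB ?ltr0n; lia.
  rewrite mulNr lerN2.
  have -> : (N%:R - j%:R)^-1 - N%:R^-1 = j%:R / (N%:R * (N%:R - j%:R)) :> R.
    by field; rewrite !gt_eqF.
  rewrite mulf_div mul1r; apply: ler_wpM2l => //.
  rewrite lef_pV2 ?posrE ?mulr_gt0 // !ler_pM2l ?ler_pM2r //.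
  by rewrite gerBl.
apply: le_trans hs _.
(* By 2 L <= N the error 1 / (2 (N - L)) from [sum_inv_ge] is at most 1 / (2 L). *)
have : (N - L)%:R^-1 <= L%:R^-1 :> R by rewrite lef_pV2 ?posrE // ler_nat; lia.
have : 0 < N%:R^-1 :> R by rewrite invr_gt0.
rewrite hln invfM; move: h.
set S := \sum_(_ < _) _; set u := N%:R^-1; set v := (N - L)%:R^-1; set w := L%:R^-1.
lra.
Qed.

End Chain.

(** * Equal halves *)

Section EqualHalves.
Variable R : realType.

(* Each step away from the centre contributes two factors whose product is at
   least ((N - n + 1) / (n + 1)) ^ 2. *)
Lemma lnbin_diff (L n a b : nat) : (a + b = n)%N -> (b <= a)%N -> (n <= L)%N ->
  (a - b)%:R * ln ((L.*2 - n).+1%:R / n.+1%:R) <= lnbin R L a - lnbin R L b.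
Proof.
move=> abn ba nL.
pose rho : R := (L.*2 - n).+1%:R / n.+1%:R.
have r0 : 0 < rho by rewrite divr_gt0 ?ltr0n.
(* Induction on the distance d = a - b in steps of two, as a + b = n stays fixed. For d = 1 equality
   holds. *)
have key d : forall b', (b' + d + b' <= L)%N -> (b' + d + b' = n)%N ->
    rho ^+ d * 'C(L, b')%:R <= 'C(L, b' + d)%:R.
  have [m] := ubnP d; elim: m d => // m IH [|[|d]] dm b' bL bn.
  - by rewrite expr0 mul1r addn0.
  - rewrite expr1 addn1 le_eqVlt; apply/orP; left; apply/eqP.
    have /(congr1 (fun k => k%:R : R)) := mul_bin_left L b'.
    rewrite !natrM => e.
    have h0 : b'.+1%:R != 0 :> R by rewrite pnatr_eq0.
    have -> : 'C(L, b'.+1)%:R = (L - b')%:R * 'C(L, b')%:R / b'.+1%:R :> R.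
      by rewrite -e mulrC mulKf.
    rewrite /rho (_ : (L.*2 - n).+1 = 2 * (L - b'))%N; last lia.
    rewrite (_ : n.+1 = 2 * b'.+1)%N; last lia.
    by rewrite !natrM; field; rewrite nat1r.
  have h := IH d _ b'.+1 _ _.
  have {}h : rho ^+ d * 'C(L, b'.+1)%:R <= 'C(L, b'.+1 + d)%:R by apply: h; lia.
  have /(congr1 (fun k => k%:R : R)) := mul_bin_left L b'; rewrite !natrM => e1.
  have /(congr1 (fun k => k%:R : R)) := mul_bin_left L (b'.+1 + d); rewrite !natrM => e2.
  rewrite (_ : b' + d.+2 = (b'.+1 + d).+1)%N; last lia.
  have p1 : 0 < b'.+1%:R :> R by rewrite ltr0n.
  have p2 : 0 < (b'.+1 + d).+1%:R :> R by rewrite ltr0n.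
  have p3 : 0 < (L - b')%:R :> R by rewrite ltr0n; lia.
  have -> : 'C(L, (b'.+1 + d).+1)%:R =
      (L - (b'.+1 + d))%:R * 'C(L, b'.+1 + d)%:R / (b'.+1 + d).+1%:R :> R.
    by rewrite -e2 mulrC mulKf // gt_eqF.
  have -> : 'C(L, b')%:R = b'.+1%:R * 'C(L, b'.+1)%:R / (L - b')%:R :> R.
    by rewrite e1 mulrC mulKf // gt_eqF.
  set X : R := rho ^+ d * 'C(L, b'.+1)%:R in h *.
  have X0 : 0 <= X by apply: mulr_ge0 => //; apply/exprn_ge0/ltW.
  have -> : rho ^+ d.+2 * (b'.+1%:R * 'C(L, b'.+1)%:R / (L - b')%:R) =
     X * (rho ^+ 2 * b'.+1%:R / (L - b')%:R) by rewrite /X !exprS; field; rewrite gt_eqF.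
  apply: (@le_trans _ _ (X * ((L - (b'.+1 + d))%:R / (b'.+1 + d).+1%:R))); last first.
    rewrite [leRHS](_ : _ = 'C(L, b'.+1 + d)%:R * ((L - (b'.+1 + d))%:R / (b'.+1 + d).+1%:R)).
      by apply: ler_wpM2r h; rewrite divr_ge0.
    by ring.
  apply: ler_wpM2l => //.
  rewrite ler_pdivrMr // [leRHS]mulrAC ler_pdivlMr //.
  rewrite [leLHS](_ : _ =
      (L.*2 - n).+1%:R ^+ 2 * (b'.+1%:R * (b'.+1 + d).+1%:R) / n.+1%:R ^+ 2); last first.
    by rewrite /rho expr_div_n; ring.
  rewrite ler_pdivrMr ?exprn_gt0 ?ltr0n //.
  (* With q = 2 L - n + 1, c = n + 1, s = d + 1, this is
     q^2 (c^2 - s^2) <= (q^2 - s^2) c^2, up to a factor 1 / 4. *)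
  have -> : b'.+1%:R = (n%:R + 1 - (d%:R + 1)) / 2 :> R.
    by rewrite -bn -natr1 !natrD -[d.+2]addn2 natrD; field.
  have -> : (b'.+1 + d).+1%:R = (n%:R + 1 + (d%:R + 1)) / 2 :> R.
    by rewrite -bn -natr1 !natrD -[b'.+1]addn1 natrD -[d.+2]addn2 natrD; field.
  have -> : (L - b')%:R = ((L.*2 - n).+1%:R + (d%:R + 1)) / 2 :> R.
    rewrite -[(L.*2 - n).+1]addn1 natrD !natrB; [|lia..].
    by rewrite -bn -mul2n !natrM !natrD -[d.+2]addn2 natrD; field.
  have -> : (L - (b'.+1 + d))%:R = ((L.*2 - n).+1%:R - (d%:R + 1)) / 2 :> R.
    rewrite -[(L.*2 - n).+1]addn1 natrD !natrB; [|lia..].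
    by rewrite -bn -mul2n !natrM !natrD -[b'.+1]addn1 natrD -[d.+2]addn2 natrD; field.
  have hq : n.+1%:R <= (L.*2 - n).+1%:R :> R by rewrite ler_nat; lia.
  have ec : n.+1%:R = n%:R + 1 :> R by rewrite natr1.
  rewrite ec in hq *; move: hq; set q := (L.*2 - n).+1%:R; set c := n%:R + 1; set s := d%:R + 1.
  move=> hq; have c0 : 0 < c by rewrite /c natr1 ltr0n.
  have : 0 <= (s ^+ 2 * ((q - c) * (q + c))) / 4.
    by rewrite divr_ge0 // mulr_ge0 ?sqr_ge0 // mulr_ge0 ?subr_ge0 // addr_ge0 ?ltW // (lt_le_trans c0).
  by move=> hh; rewrite -subr_ge0; move: hh; congr (_ <= _); field.
have h := key (a - b)%N b _ _.
have {}h : rho ^+ (a - b) * 'C(L, b)%:R <= 'C(L, b + (a - b))%:R by apply: h; lia.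
rewrite subnKC // in h.
have B0 : 0 < 'C(L, b)%:R :> R by rewrite ltr0n bin_gt0; lia.
have A0 : 0 < 'C(L, a)%:R :> R by rewrite ltr0n bin_gt0; lia.
rewrite -/rho mulr_natl -lnXn // lerBrDr /lnbin -lnM ?posrE ?exprn_gt0 //.
by rewrite ler_ln ?posrE ?mulr_gt0 ?exprn_gt0.
Qed.

Lemma lnbin_dist (L n a b : nat) : (a + b = n)%N -> (n <= L)%N ->
  `|a%:R - b%:R| * ln ((L.*2 - n).+1%:R / n.+1%:R) <= `|lnbin R L a - lnbin R L b|.
Proof.
move=> abn nL; case/orP: (leq_total b a) => ab.
  rewrite -natrB // ger0_norm ?ler0n //; apply: le_trans (ler_norm _).
  exact: lnbin_diff.
rewrite distrC -natrB // ger0_norm ?ler0n // distrC; apply: le_trans (ler_norm _).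
by apply: lnbin_diff => //; rewrite addnC.
Qed.

Definition hyp_weight (L n k : nat) : R :=
  'C(L, k)%:R * 'C(L, n - k)%:R / 'C(L.*2, n)%:R.

(** A discrete antiderivative of the weighted deviation (see [hyp_potentialB]), which makes partial
    sums of it telescope. *)
Definition hyp_potential (L n k : nat) : R :=
  k%:R * (L - n + k)%:R / L%:R * hyp_weight L n k.

(** Based on k (L - n + k) - (L - k) (n - k) = L (2 k - n). The case k = n is set apart because
    truncated subtraction may leave [hyp_potential L n n.+1] nonzero. *)
Lemma hyp_potentialB (L n k : nat) : (0 < L)%N -> (n <= L)%N -> (k <= n)%N ->
  (k%:R - (n - k)%:R) * hyp_weight L n k =
  hyp_potential L n k - (if (k < n)%N then hyp_potential L n k.+1 else 0).
Proof.
move=> L0 nL kn; rewrite /hyp_potential /hyp_weight.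
have L0' : L%:R != 0 :> R by rewrite pnatr_eq0 -lt0n.
have D0 : 'C(L.*2, n)%:R != 0 :> R by rewrite pnatr_eq0 -lt0n bin_gt0; lia.
case: ltnP => [ltkn|]; last first.
  move=> nk; have -> : k = n by lia.
  by rewrite subnn subnK // bin0; field; rewrite L0' D0.
have /(congr1 (fun k => k%:R : R)) := mul_bin_left L k; rewrite !natrM => e1.
have /(congr1 (fun k => k%:R : R)) := mul_bin_left L (n - k.+1); rewrite !natrM => e2.
have e3 : (n - k = (n - k.+1).+1)%N by lia.
rewrite -e3 in e2.
have e4 : (L - n + k.+1 = L - (n - k.+1))%N by lia.
rewrite e4.
transitivity ((k%:R : R) * (L - n + k)%:R / L%:R * ('C(L, k)%:R * 'C(L, n - k)%:R / 'C(L.*2, n)%:R)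
  - ((L - k)%:R * 'C(L, k)%:R) * ((n - k)%:R * 'C(L, n - k)%:R) / (L%:R * 'C(L.*2, n)%:R)).
  have -> : (L - n + k)%:R = L%:R - n%:R + k%:R :> R by rewrite natrD natrB.
  rewrite (natrB _ kn) natrB; last lia.
  by field; rewrite L0' D0.
rewrite -e1 e2; congr (_ - _); field; by rewrite L0' D0.
Qed.

(** The absolute value dominates the deviation from [j] on and its negative below [j]; each of the
    two partial sums telescopes to the potential at [j]. *)
Lemma hyp_abs_dev (L n j : nat) : (0 < L)%N -> (n <= L)%N -> (j <= n)%N ->
  2 * hyp_potential L n j <= \sum_(k < n.+1) `|k%:R - (n - k)%:R| * hyp_weight L n k.
Proof.
move=> L0 nL jn.
have w0 k : 0 <= hyp_weight L n k by rewrite divr_ge0 ?mulr_ge0.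
pose F k : R := (k%:R - (n - k)%:R) * hyp_weight L n k.
pose T k : R := if (k <= n)%N then hyp_potential L n k else 0.
have FT k : (k <= n)%N -> F k = T k - T k.+1.
  by move=> kn; rewrite /F hyp_potentialB // /T kn.
have T0 : T 0 = 0 by rewrite /T /= /hyp_potential !mul0r.
have up : T j = \sum_(j <= k < n.+1) F k.
  have -> : \sum_(j <= k < n.+1) F k = \sum_(j <= k < n.+1) (T k - T k.+1).
    by apply: eq_big_nat => k /andP[_ kn]; apply: FT.
  rewrite -[LHS]opprK -[RHS]opprK -sumrN.
  under eq_bigr do rewrite opprB.
  by rewrite telescope_sumr ?(leqW jn) // /T ltnn sub0r.
have lo : - T j = \sum_(0 <= k < j) F k.
  have -> : \sum_(0 <= k < j) F k = \sum_(0 <= k < j) (T k - T k.+1).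
    by apply: eq_big_nat => k /andP[_ kn]; apply: FT; lia.
  rewrite -[RHS]opprK -sumrN.
  under eq_bigr do rewrite opprB.
  by rewrite telescope_sumr // T0 subr0.
have -> : hyp_potential L n j = T j by rewrite /T jn.
rewrite -(big_mkord predT (fun k => `|k%:R - (n - k)%:R| * hyp_weight L n k)).
rewrite (big_cat_nat (n := j)) //=; last exact: leqW.
have -> : 2 * T j = - - T j + T j by ring.
rewrite lo up -sumrN; apply: lerD; apply: ler_sum => k _.
  by rewrite /F -mulNr ler_wpM2r // ler_normr lexx orbT.
by rewrite /F ler_wpM2r // ler_norm.
Qed.

Lemma hyp_weight_even (L x : nat) : (x <= L)%N ->
  hyp_weight L x.*2 x = cbin R x * cbin R (L - x) / cbin R L.
Proof.
move=> xL; rewrite /hyp_weight /cbin.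
have -> : (x.*2 - x = x)%N by lia.
have f4 k : 4 ^+ k != 0 :> R by rewrite expf_neq0 // pnatr_eq0.
have -> : 4 ^+ L = 4 ^+ x * 4 ^+ (L - x) :> R by rewrite -exprD subnKC.
have fact m k : (k <= m)%N -> 'C(m, k)%:R = m`!%:R / (k`!%:R * (m - k)`!%:R) :> R.
  move=> km; rewrite -(bin_fact km) !natrM mulfK // -natrM pnatr_eq0 -lt0n muln_gt0 !fact_gt0 //.
have nf k : k`!%:R != 0 :> R by rewrite pnatr_eq0 -lt0n fact_gt0.
rewrite !fact; try lia.
rewrite (_ : L.*2 - x.*2 = (L - x).*2)%N; last lia.
rewrite (_ : x.*2 - x = x)%N; last lia.
rewrite (_ : L.*2 - L = L)%N; last lia.
rewrite (_ : (L - x).*2 - (L - x) = L - x)%N; last lia.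
by field; rewrite !nf !f4.
Qed.

(** [cbin_lower] bounds the factor at [L - x], and [cbin_antitone] the quotient of those at [x] and
    [L], so pi enters only once. *)
Lemma hyp_weight_even_ge (L x : nat) : (x <= L)%N ->
  (L%:R + 1 / 2) <= pi * (x%:R + 1 / 2) * ((L - x)%:R + 1 / 2) * hyp_weight L x.*2 x ^+ 2.
Proof.
move=> xL; rewrite hyp_weight_even //.
have h1 := cbin_lower R (L - x).
have h2 := cbin_antitone R xL.
have c0 := cbin_gt0 R L.
rewrite expr_div_n exprMn -(ler_pM2r (_ : 0 < cbin R L ^+ 2)) ?exprn_gt0 //.
apply: le_trans h2 _.
have p0 : 0 <= (x%:R + 1 / 2) * cbin R x ^+ 2.
  by rewrite mulr_ge0 ?exprn_ge0 ?(ltW (cbin_gt0 R x)) // addr_ge0.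
have := ler_wpM2l p0 h1; rewrite mulr1 => /le_trans; apply.
rewrite le_eqVlt; apply/orP; left; apply/eqP; field; rewrite ?gt_eqF //.
Qed.

(* The value n / (n + 1) is what the half-integer corrections cost. *)
Lemma hyp_potential_ge (L n : nat) : (0 < n)%N -> (n <= L)%N ->
  exists2 j, (j <= n)%N &
  Num.sqrt (n%:R * (L.*2 - n)%:R / (4 * L%:R * pi)) * (n%:R / n.+1%:R) <= hyp_potential L n j.
Proof.
move=> n0 nL.
have L0 : (0 < L)%N by lia.
have L0' : 0 < L%:R :> R by rewrite ltr0n.
have pi0 : 0 < pi :> R := pi_gt0 R.
have w0 k : 0 <= hyp_weight L n k by rewrite divr_ge0 ?mulr_ge0.
have T0 k : 0 <= hyp_potential L n k by rewrite /hyp_potential mulr_ge0 // divr_ge0 // mulr_ge0.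
have sq (y : R) j : 0 <= y -> y * (n%:R / n.+1%:R) ^+ 2 <= hyp_potential L n j ^+ 2 ->
    Num.sqrt y * (n%:R / n.+1%:R) <= hyp_potential L n j.
  move=> y0 h; have t0 : 0 <= Num.sqrt y * (n%:R / n.+1%:R).
    by rewrite mulr_ge0 ?sqrtr_ge0 // divr_ge0.
  rewrite -(@ler_pXn2r _ 2) ?nnegrE //.
  by rewrite exprMn sqr_sqrtr.
have y0 : 0 <= n%:R * (L.*2 - n)%:R / (4 * L%:R * pi) :> R.
  by apply: divr_ge0; rewrite ?mulr_ge0 // ltW.
(* By [hyp_potentialB] the potential is largest at n / 2 rounded up, which is the witness [x]. *)
have [x [nx|nx]] : exists x, n = x.*2 \/ n.+1 = x.*2.
  exists (uphalf n); lia.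
- exists x; first lia.
  apply: sq => //; rewrite /hyp_potential.
  have xL : (x <= L)%N by lia.
  have h := hyp_weight_even_ge xL; rewrite -nx in h.
  have -> : (L - n + x = L - x)%N by lia.
  set w := hyp_weight L n x ^+ 2 in h.
  have -> : (x%:R * (L - x)%:R / L%:R * hyp_weight L n x) ^+ 2 =
     (x%:R * (L - x)%:R / L%:R) ^+ 2 * w by rewrite exprMn.
  have -> : (L.*2 - n)%:R = 2 * (L - x)%:R :> R by rewrite -natrM; congr (_%:R); lia.
  have -> : n%:R = 2 * x%:R :> R by rewrite -natrM; congr (_%:R); lia.
  have -> : n.+1%:R = 2 * x%:R + 1 :> R by rewrite -natr1 -natrM; congr (_%:R + 1); lia.
  have xz : x%:R <= (L - x)%:R :> R by rewrite ler_nat; lia.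
  have eL : L%:R = x%:R + (L - x)%:R :> R by rewrite -natrD; congr (_%:R); lia.
  have x0 : 0 < x%:R :> R by rewrite ltr0n; lia.
  move: h xz eL L0'; set z := (L - x)%:R; set u := x%:R; set l := L%:R => h xz eL L0'.
  have z0 : 0 < z by apply: lt_le_trans xz.
  have hw : (l + 1 / 2) / (pi * (u + 1 / 2) * (z + 1 / 2)) <= w.
    rewrite ler_pdivrMr; first by rewrite [leRHS]mulrC.
    by rewrite !mulr_gt0 // addr_gt0.
  apply: le_trans (ler_wpM2l (sqr_ge0 _) hw).
  have num : 0 <= z * l + z * u + z / 2 - u * l.
    have : 0 <= (z - u) * l by rewrite mulr_ge0 ?subr_ge0 // ltW.
    have : 0 <= z * u by rewrite mulr_ge0 // ltW.
    by lra.
  have d1 : 0 < u + 1 / 2 by lra.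
  have d2 : 0 < z + 1 / 2 by lra.
  rewrite -subr_ge0.
  have : 0 <= u * z / (l * pi) * (u / (u + 1 / 2)) *
      ((z * l + z * u + z / 2 - u * l) / 2 / (l * (z + 1 / 2) * (u + 1 / 2))).
    by rewrite !(mulr_ge0, invr_ge0) // ltW.
  congr (_ <= _); field.
  by rewrite !gt_eqF //; lra.
exists x; first lia.
apply: sq => //.
have [m em] : exists m, x = m.+1 by exists x.-1; lia.
have xL : (x <= L)%N by lia.
have h := hyp_weight_even_ge xL.
have x0 : 0 < x%:R :> R by rewrite ltr0n; lia.
(* For odd n the potential is expressed through the central weight for n + 1 = 2 x, to which
   [hyp_weight_even_ge] applies. *)
have -> : hyp_potential L n x = x%:R * ((L - x)%:R + 1 / 2) / L%:R * hyp_weight L x.*2 x.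
  rewrite /hyp_potential /hyp_weight.
  have -> : (L - n + x = L - m)%N by lia.
  have -> : (n - x = m)%N by lia.
  have -> : (x.*2 - x = x)%N by lia.
  have /(congr1 (fun k => k%:R : R)) := mul_bin_left L m; rewrite !natrM -em => e1.
  have /(congr1 (fun k => k%:R : R)) := mul_bin_left L.*2 n; rewrite !natrM nx => e2.
  have B1 : 'C(L.*2, n)%:R != 0 :> R by rewrite pnatr_eq0 -lt0n bin_gt0; lia.
  have B2 : 'C(L.*2, x.*2)%:R != 0 :> R by rewrite pnatr_eq0 -lt0n bin_gt0; lia.
  have B3 : (L.*2 - n)%:R != 0 :> R by rewrite pnatr_eq0; lia.
  have B4 : x.*2%:R != 0 :> R by rewrite pnatr_eq0; lia.
  have B5 : (L - m)%:R != 0 :> R by rewrite pnatr_eq0; lia.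
  have -> : 'C(L.*2, n)%:R = x.*2%:R * 'C(L.*2, x.*2)%:R / (L.*2 - n)%:R :> R.
    by rewrite e2 mulrC mulKf.
  have -> : 'C(L, m)%:R = x%:R * 'C(L, x)%:R / (L - m)%:R :> R.
    by rewrite e1 mulrC mulKf.
  have -> : (L - x)%:R + 1 / 2 = (L.*2 - n)%:R / 2 :> R.
    rewrite (_ : (L.*2 - n = 2 * (L - x) + 1)%N); last lia.
    by rewrite natrD natrM; field.
  have e3 : x.*2%:R = 2 * x%:R :> R by rewrite -natrM mul2n.
  rewrite e3 in B4 *; field.
  by rewrite B2 B3 B5 !gt_eqF.
have -> : (L.*2 - n)%:R = 2 * (L - x)%:R + 1 :> R by rewrite -natrM natr1; congr (_%:R); lia.
have n1 : 0 < n%:R :> R by rewrite ltr0n.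
have y1 : 0 <= n%:R * (2 * (L - x)%:R + 1) / (4 * L%:R * pi) :> R.
  have zz : 0 <= 2 * (L - x)%:R + 1 :> R by rewrite addr_ge0 // mulr_ge0.
  by rewrite !(mulr_ge0, invr_ge0) // ltW.
apply: (@le_trans _ _ (n%:R * (2 * (L - x)%:R + 1) / (4 * L%:R * pi))).
  rewrite -[leRHS]mulr1; apply: ler_wpM2l => //.
  by rewrite expr_le1 ?divr_ge0 // ler_pdivrMr ?ltr0n // mul1r ler_nat.
have -> : n%:R = 2 * x%:R - 1 :> R.
  by rewrite -natrM -[in RHS](_ : n.+1 = 2 * x)%N -?natr1 ?addrK //; lia.
have z0 : 0 <= (L - x)%:R :> R by [].
set w := hyp_weight L x.*2 x in h *; rewrite exprMn.
move: h L0' z0 x0; set z := (L - x)%:R; set u := x%:R; set l := L%:R => h l0 z0 x0.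
have d1 : 0 < u + 1 / 2 by lra.
have d2 : 0 < z + 1 / 2 by lra.
have hw : (l + 1 / 2) / (pi * (u + 1 / 2) * (z + 1 / 2)) <= w ^+ 2.
  rewrite ler_pdivrMr; first by rewrite [leRHS]mulrC.
  by rewrite !mulr_gt0.
apply: le_trans (ler_wpM2l (sqr_ge0 _) hw).
rewrite -subr_ge0.
have : 0 <= (z + 1 / 2) / (l * pi) * ((u ^+ 2 / 2 + l / 4) / (l * (u + 1 / 2))).
  have a0 : 0 <= u ^+ 2 / 2 + l / 4 by rewrite addr_ge0 // divr_ge0 // ?sqr_ge0 // ltW.
  by rewrite !(mulr_ge0, invr_ge0) // ltW.
congr (_ <= _); field.
by rewrite !gt_eqF //; lra.
Qed.

End EqualHalves.

(** * Logarithmic sums over the particle-number sectors *)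

Section PageSum.
Variable R : realType.

Definition sector_weight (N n L k : nat) : R :=
  (maxn 'C(L, k) 'C(N - L, n - k))%:R / 'C(N, n)%:R.

Lemma sector_weight_ge0 N n L k : 0 <= sector_weight N n L k.
Proof. by rewrite divr_ge0. Qed.

Lemma sector_weight_gt0 N n L k : (n <= N)%N -> (k <= L)%N -> 0 < sector_weight N n L k.
Proof.
move=> nN kL; rewrite divr_gt0 ?ltr0n ?bin_gt0 //.
by rewrite leq_max bin_gt0 kL.
Qed.

(** Maximum times minimum is the product, which leaves Vandermonde's identity. This is the
    normalization that Klein's inequality asks for. *)
Lemma sum_sector_weight N n L : (L <= N)%N -> (n <= N)%N ->
  \sum_(k < n.+1) sector_weight N n L k * (minn 'C(L, k) 'C(N - L, n - k))%:R = 1.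
Proof.
move=> LN nN.
have B0 : 'C(N, n)%:R != 0 :> R by rewrite pnatr_eq0 -lt0n bin_gt0.
transitivity (\sum_(k < n.+1) ('C(L, k) * 'C(N - L, n - k))%:R / 'C(N, n)%:R : R).
  apply: eq_bigr => k _; rewrite /sector_weight mulrAC -natrM; congr (_%:R / _).
  by case: (leqP 'C(L, k) 'C(N - L, n - k)) => _; rewrite mulnC.
by rewrite -mulr_suml -natr_sum binomial.Vandermonde subnKC // divff.
Qed.

(* hyp_mean counts the successes left, the right-hand side those drawn. *)
Lemma hyp_mean_rev N n L g :
  hyp_mean N n L g = ('C(N, n)%:R)^-1 *
   \sum_(k < n.+1) ('C(L, k) * 'C(N - L, n - k))%:R * g (n - k)%N :> R.
Proof.
congr (_ * _); rewrite (reindex_inj rev_ord_inj) /=.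
apply: eq_bigr => k _; rewrite subSS.
by rewrite subKn // -ltnS.
Qed.

Lemma page_sum_le N n L : (n.*2 <= N)%N -> (L.*2 <= N)%N ->
  - (('C(N, n)%:R)^-1 * \sum_(k < n.+1) ('C(L, k) * 'C(N - L, n - k))%:R * ln (sector_weight N n L k))
  <= lnbin R N n - hyp_mean N n L (lnbin R (N - L)).
Proof.
move=> n2 L2.
have nN : (n <= N)%N by lia.
have LN : (L <= N)%N by lia.
have h1 := @hyp_mean_cst R N n L (lnbin R N n) nN LN.
rewrite -{1}h1 !hyp_mean_rev -mulrBr -mulrN; apply: ler_wpM2l; first by rewrite invr_ge0.
rewrite -sumrN -sumrB; apply: ler_sum => k _.
rewrite -mulrN -mulrBr; apply: ler_wpM2l => //.
have kn : (k <= n)%N by rewrite -ltnS.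
have B0 : 0 < 'C(N, n)%:R :> R by rewrite ltr0n bin_gt0.
have B1 : 0 < 'C(N - L, n - k)%:R :> R by rewrite ltr0n bin_gt0; lia.
have B2 : 0 < (maxn 'C(L, k) 'C(N - L, n - k))%:R :> R.
  by apply: lt_le_trans B1 _; rewrite ler_nat leq_maxr.
rewrite /sector_weight /lnbin ln_div ?posrE // opprB lerD2l lerN2 ler_ln ?posrE //.
by rewrite ler_nat leq_maxr.
Qed.

(** The arithmetic mean of the two logarithms reproduces the bound of [page_sum_le]; half their
    absolute difference gives the extra term through [lnbin_dist] and [hyp_abs_dev]. *)
Lemma page_sum_half_le L n j : (0 < L)%N -> (n <= L)%N -> (j <= n)%N ->
  - (('C(L.*2, n)%:R)^-1 * \sum_(k < n.+1)
       ('C(L, k) * 'C(L.*2 - L, n - k))%:R * ln (sector_weight L.*2 n L k))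
  <= lnbin R L.*2 n - hyp_mean L.*2 n L (lnbin R (L.*2 - L))
     - hyp_potential R L n j * ln ((L.*2 - n).+1%:R / n.+1%:R).
Proof.
move=> L0 nL jn.
have nN : (n <= L.*2)%N by lia.
have LN : (L <= L.*2)%N by lia.
set lq := ln _.
have lq0 : 0 <= lq.
  by rewrite ln_ge0 // ler_pdivlMr ?ltr0n // mul1r ler_nat; lia.
have h1 := @hyp_mean_cst R L.*2 n L (lnbin R L.*2 n) nN LN.
rewrite -{1}h1 !hyp_mean_rev.
have -> : (L.*2 - L = L)%N by lia.
set D := ('C(L.*2, n)%:R)^-1.
have D0 : 0 < D by rewrite invr_gt0 ltr0n bin_gt0.
pose P (k : nat) : R := ('C(L, k) * 'C(L, n - k))%:R.
(* With equal halves the distribution is symmetric under k -> n - k, so both logarithms have the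
   same mean. *)
have Psym (g : nat -> R) : \sum_(k < n.+1) P k * g k = \sum_(k < n.+1) P k * g (n - k)%N.
  rewrite (reindex_inj rev_ord_inj) /=; apply: eq_bigr => k _; rewrite subSS /P.
  have kn : (k <= n)%N by rewrite -ltnS.
  by congr (_%:R * _); rewrite subKn // mulnC.
have B (k : 'I_n.+1) : 0 < 'C(L, k)%:R :> R by rewrite ltr0n bin_gt0; have := ltn_ord k; lia.
have B' (k : 'I_n.+1) : 0 < 'C(L, n - k)%:R :> R by rewrite ltr0n bin_gt0; lia.
have N0 : 0 < 'C(L.*2, n)%:R :> R by rewrite ltr0n bin_gt0.
have lnw (k : 'I_n.+1) : ln (sector_weight L.*2 n L k) =
   (lnbin R L k + lnbin R L (n - k) + `|lnbin R L k - lnbin R L (n - k)|) / 2 - lnbin R L.*2 n.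
  rewrite /sector_weight (_ : (L.*2 - L = L)%N); last lia.
  rewrite ln_div ?posrE //; last by rewrite ltr0n leq_max bin_gt0; have := ltn_ord k; lia.
  congr (_ - _); rewrite /lnbin; have Bk := B k; have Bk' := B' k.
  case: (leqP 'C(L, k) 'C(L, n - k)) => h.
    have : ln 'C(L, k)%:R <= ln 'C(L, n - k)%:R :> R by rewrite ler_ln ?posrE // ler_nat.
    move=> {}h; rewrite distrC ger0_norm ?subr_ge0 //; lra.
  have : ln 'C(L, n - k)%:R <= ln 'C(L, k)%:R :> R by rewrite ler_ln ?posrE // ler_nat ltnW.
  move=> {}h; rewrite ger0_norm ?subr_ge0 //; lra.
have hdev := hyp_abs_dev R L0 nL jn.
have key : 2 * hyp_potential R L n j * lq <=
    D * \sum_(k < n.+1) P k * `|lnbin R L k - lnbin R L (n - k)|.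
  apply: le_trans (ler_wpM2r lq0 hdev) _.
  rewrite mulr_suml mulr_sumr; apply: ler_sum => k _.
  have kn : (k <= n)%N by rewrite -ltnS.
  have h := lnbin_dist R (subnKC kn) nL.
  have P0 : 0 <= D * P k by rewrite mulr_ge0 // ltW.
  have := ler_wpM2l P0 h; rewrite -/lq => hk.
  have ew : hyp_weight R L n k = D * P k by rewrite /hyp_weight /P natrM mulrC.
  rewrite ew [leLHS](_ : _ = D * P k * (`|k%:R - (n - k)%:R| * lq)); last by ring.
  by rewrite [leRHS]mulrA.
have -> : \sum_(k < n.+1) P k * ln (sector_weight L.*2 n L k) =
  \sum_(k < n.+1) P k * lnbin R L (n - k)
  + (\sum_(k < n.+1) P k * `|lnbin R L k - lnbin R L (n - k)|) / 2
  - \sum_(k < n.+1) P k * lnbin R L.*2 n.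
  rewrite -[X in _ = X + _ - _](_ : (\sum_(k < n.+1) P k * lnbin R L k
      + \sum_(k < n.+1) P k * lnbin R L (n - k)) / 2 = _); last first.
    by rewrite (Psym (lnbin R L)); field.
  rewrite -big_split /= !mulr_suml -big_split /= -sumrB; apply: eq_bigr => k _.
  by rewrite lnw; ring.
move: key; set S1 := \sum_(_ < _) _ * lnbin R L (n - _); set S2 := \sum_(_ < _) _ * `|_|.
set S3 := \sum_(_ < _) _ => key.
rewrite [leLHS](_ : _ = D * S3 - D * S1 - D * S2 / 2); last by ring.
rewrite lerD2l lerN2 ler_pdivlMr //.
by rewrite mulrC mulrA.
Qed.

End PageSum.

(** * Entropy of graded pure states *)

Section Entropy.
Local Open Scope complex_scope.
Local Open Scope sesquilinear_scope.
Variable R : realType.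
Local Notation C := R[i].

Definition sqn (z : C) : R := complex.Re z ^+ 2 + complex.Im z ^+ 2.

Lemma sqnE z : (sqn z)%:C = z * Num.conj z.
Proof. by case: z => a b; rewrite /sqn /=; simpc; congr (_ +i* _); rewrite ?expr2; ring. Qed.

Lemma sqn_ge0 z : 0 <= sqn z.
Proof. by rewrite addr_ge0 ?sqr_ge0. Qed.

Lemma sqn0 : sqn 0 = 0.
Proof. by rewrite /sqn /= expr0n addr0. Qed.

Lemma ReM_real (a : R) (z : C) : complex.Re (a%:C * z) = a * complex.Re z.
Proof. by case: z => x y /=; rewrite mul0r subr0. Qed.

Lemma Re_sum (I : finType) (P : pred I) (F : I -> C) :
  complex.Re (\sum_(i | P i) F i) = \sum_(i | P i) complex.Re (F i).
Proof. exact: (raddf_sum (@complex.Re R)). Qed.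

Lemma adjmxE m n (A : 'M[C]_(m, n)) x y : (A ^t*) x y = Num.conj (A y x).
Proof. by rewrite !mxE. Qed.

Lemma realC_sum (I : finType) (P : pred I) (F : I -> R) :
  (\sum_(i | P i) F i)%:C = \sum_(i | P i) (F i)%:C.
Proof. exact: (raddf_sum (real_complex R)). Qed.

Lemma realC_inj : injective (real_complex R).
Proof. by move=> a b []. Qed.

(** ln y <= y - 1 at y = q / x. The indicator makes zero eigenvalues free of charge; through it the
    rank of the state enters. *)
Lemma klein_scalar (x q : R) : 0 <= x -> 0 < q ->
  - (x * ln x) <= - x * ln q - x + q * (0 < x)%R%:R.
Proof.
move=> x0 q0; move: x0; rewrite le_eqVlt => /predU1P[<-|x0].
  by rewrite ltxx !(mulr0, mul0r, oppr0, subr0, addr0).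
rewrite x0 mulr1.
have := @le_ln1Dx R (q / x - 1).
rewrite addrCA subrr addr0 lnM ?posrE ?invr_gt0 // lnV ?posrE // => h.
have {}h : ln q - ln x <= q / x - 1.
  by apply: h; rewrite ltrBrDl subrr divr_gt0.
have := ler_wpM2l (ltW x0) h.
have -> : x * (q / x - 1) = q - x by field; rewrite gt_eqF.
rewrite mulrBr; lra.
Qed.

Section PureState.
Variables (a b : nat) (W : 'M[C]_(a, b)).
Let rho := W *m W ^t*.
Let U := spectralmx rho.
(** The rows of [V] are orthogonal with squared norms [lam i]: right singular vectors of [W], not
    normalized. *)
Let V := U *m W.
Let lam i := complex.Re (spectral_diag rho 0 i).

Lemma rho_herm : rho ^t* = rho.
Proof. by rewrite /rho trmx_mul map_mxM trmxCK. Qed.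

Lemma rho_spectral : rho = U ^t* *m diag_mx (spectral_diag rho) *m U.
Proof.
have n : rho \is normalmx by apply/normalmxP; rewrite rho_herm.
by rewrite {1}(orthomx_spectralP n) invmx_unitary // spectral_unitarymx.
Qed.

Lemma UUt : U *m U ^t* = 1%:M.
Proof. by apply/unitarymxP/spectral_unitarymx. Qed.

Lemma UtU : U ^t* *m U = 1%:M.
Proof. by apply: mulmx1C; apply: UUt. Qed.

Lemma VVt : V *m V ^t* = diag_mx (spectral_diag rho).
Proof.
rewrite /V trmx_mul map_mxM mulmxA -[in LHS](mulmxA U W) -/rho.
by rewrite {1}rho_spectral !mulmxA UUt mul1mx -mulmxA UUt mulmx1.
Qed.

Lemma spectral_lam i : spectral_diag rho 0 i = (lam i)%:C.
Proof.
have := congr1 (fun M : 'M[C]_a => M i i) VVt; rewrite /= mxE [RHS]mxE eqxx mulr1n => e.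
rewrite /lam -e Re_sum realC_sum; apply: eq_bigr => j _.
by rewrite adjmxE -sqnE.
Qed.

Lemma sum_V i i' : \sum_y V i y * Num.conj (V i' y) = (lam i)%:C *+ (i == i').
Proof.
have := congr1 (fun M : 'M[C]_a => M i i') VVt; rewrite /= mxE [RHS]mxE.
by rewrite spectral_lam => <-; apply: eq_bigr => j _; rewrite adjmxE.
Qed.

Lemma lamE i : lam i = \sum_y sqn (V i y).
Proof.
apply: realC_inj; rewrite realC_sum.
have := sum_V i i; rewrite eqxx mulr1n => <-.
by apply: eq_bigr => y _; rewrite sqnE.
Qed.

Lemma lam_ge0 i : 0 <= lam i.
Proof. by rewrite lamE sumr_ge0 // => y _; apply: sqn_ge0. Qed.

Lemma sum_U_row i : \sum_x sqn (U i x) = 1.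
Proof.
apply: realC_inj; rewrite realC_sum.
have := congr1 (fun M : 'M[C]_a => M i i) UUt; rewrite /= mxE [RHS]mxE eqxx => e; apply: etrans e.
by apply: eq_bigr => x _; rewrite adjmxE -sqnE.
Qed.

Lemma sum_U_col x : \sum_i sqn (U i x) = 1.
Proof.
apply: realC_inj; rewrite realC_sum.
have := congr1 (fun M : 'M[C]_a => M x x) UtU; rewrite /= mxE [RHS]mxE eqxx => e; apply: etrans e.
by apply: eq_bigr => i _; rewrite adjmxE mulrC -sqnE.
Qed.

Lemma rho_diagE x : rho x x = (\sum_i lam i * sqn (U i x))%:C.
Proof.
rewrite {1}rho_spectral mxE realC_sum; apply: eq_bigr => i _.
rewrite mul_mx_diag mxE adjmxE spectral_lam rmorphM /= sqnE; ring.
Qed.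

Lemma rho_diag_sqn x : complex.Re (rho x x) = \sum_y sqn (W x y).
Proof.
rewrite mxE Re_sum; apply: eq_bigr => y _.
by rewrite adjmxE -sqnE.
Qed.

Lemma vn_entropyE : vn_entropy rho = - \sum_i lam i * ln (lam i).
Proof.
rewrite /vn_entropy /mxfun invmx_unitary ?spectral_unitarymx //.
rewrite {1}rho_spectral -/U -!mulmxA mxtrace_mulC.
set D := diag_mx (spectral_diag rho); set E := diag_mx (map_mx _ _).
have -> : D *m (U *m (U ^t* *m (E *m U))) *m U ^t* = D *m E.
  by rewrite !mulmxA -[D *m U *m _]mulmxA UUt mulmx1 -mulmxA UUt mulmx1.
rewrite /mxtrace Re_sum; congr (- _); apply: eq_bigr => i _.
rewrite mul_diag_mx mxE [X in _ * X]mxE eqxx mulr1n mxE.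
by rewrite spectral_lam ReM_real.
Qed.

(* Bessel's inequality for the right singular vectors. *)
Lemma bessel y : \sum_(i | 0 < lam i) sqn (V i y) / lam i <= 1.
Proof.
set s := \sum_(i | _) _.
have s0 : 0 <= s by apply: sumr_ge0 => i /ltW l0; rewrite divr_ge0 // sqn_ge0.
(* [z] is the orthogonal projection of the basis vector at [y] onto the span of the nonzero rows of
   [V]. Its entry at [y] and its squared norm are both s, hence s^2 <= s. *)
pose c i : C := Num.conj (V i y) * ((lam i)^-1)%:C.
pose z y' : C := \sum_(i | 0 < lam i) c i * V i y'.
have zy : z y = s%:C.
  rewrite /z /s realC_sum; apply: eq_bigr => i _.
  by rewrite rmorphM /= sqnE /c; ring.
have nz : \sum_y' sqn (z y') = s.
  apply: realC_inj; rewrite realC_sum.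
  transitivity (\sum_(i | 0 < lam i) \sum_(i' | 0 < lam i') c i * Num.conj (c i') *
      \sum_y' V i y' * Num.conj (V i' y')).
    transitivity (\sum_y' \sum_(i | 0 < lam i) \sum_(i' | 0 < lam i')
        c i * Num.conj (c i') * (V i y' * Num.conj (V i' y'))).
      apply: eq_bigr => y' _; rewrite sqnE /z rmorph_sum mulr_suml.
      apply: eq_bigr => i _; rewrite mulr_sumr; apply: eq_bigr => i' _.
      by rewrite rmorphM /=; ring.
    rewrite exchange_big; apply: eq_bigr => i _.
    rewrite exchange_big; apply: eq_bigr => i' _.
    by rewrite mulr_sumr.
  rewrite /s realC_sum; apply: eq_bigr => i li.
  rewrite (bigD1 i) //= [X in _ + X]big1 ?addr0.
    rewrite sum_V eqxx mulr1n.
    have -> : (sqn (V i y) / lam i)%:C = V i y * Num.conj (V i y) * ((lam i)^-1)%:C.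
      by rewrite -sqnE -rmorphM.
    rewrite /c rmorphM /= conjCK.
    have -> : Num.conj ((lam i)^-1)%:C = ((lam i)^-1)%:C :> C by exact: conjc_real.
    transitivity (V i y * Num.conj (V i y) * (lam i)^-1%:C * ((lam i)^-1%:C * (lam i)%:C)).
      ring.
    by rewrite -rmorphM /= mulVf ?gt_eqF // mulr1.
  by move=> i' /andP[_ ne]; rewrite sum_V eq_sym (negbTE ne) mulr0n mulr0.
have h : s ^+ 2 <= s.
  rewrite -[X in _ <= X]nz (bigD1 y) //= -[leLHS]addr0; apply: lerD; last first.
    by apply: sumr_ge0 => *; apply: sqn_ge0.
  by rewrite zy /sqn /= [X in _ + X]expr0n addr0.
have [->//|sn0] := eqVneq s 0.
have sp : 0 < s by rewrite lt_neqAle eq_sym sn0.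
by rewrite -(ler_pM2l sp) mulr1 -expr2.
Qed.

Variables (gA : 'I_a -> nat) (gB : 'I_b -> nat).
Hypothesis graded : forall x y, gA x != gB y -> W x y = 0.

(* The weights of a Schmidt pair of singular vectors agree sector by sector. *)
Lemma schmidt_weight i k :
  lam i * \sum_(x | gA x == k) sqn (U i x) = \sum_(y | gB y == k) sqn (V i y).
Proof.
apply: realC_inj; rewrite rmorphM /= !realC_sum mulr_sumr.
have e x : (lam i)%:C * U i x = \sum_y V i y * Num.conj (W x y).
  have h : diag_mx (spectral_diag rho) *m U = V *m W ^t*.
    rewrite /V -mulmxA -/rho [in RHS]rho_spectral !mulmxA UUt mul1mx //.
  have := congr1 (fun M : 'M[C]_a => M i x) h.
  rewrite /= mul_diag_mx mxE [RHS]mxE spectral_lam => ->.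
  by apply: eq_bigr => y _; rewrite adjmxE.
transitivity (\sum_(x | gA x == k) \sum_y Num.conj (U i x) * V i y * Num.conj (W x y)).
  apply: eq_bigr => x _; rewrite sqnE mulrA e mulr_suml.
  by apply: eq_bigr => y _; ring.
rewrite exchange_big /= [RHS]big_mkcond /=; apply: eq_bigr => y _.
have vy : Num.conj (V i y) = \sum_x Num.conj (U i x) * Num.conj (W x y).
  by rewrite mxE rmorph_sum; apply: eq_bigr => x _; rewrite rmorphM.
case: ifP => [/eqP gy|gy].
  rewrite sqnE vy mulr_sumr [RHS](bigID (fun x => gA x == k)) /= [X in _ = _ + X]big1 ?addr0.
    by apply: eq_bigr => x _; ring.
  by move=> x gx; rewrite graded ?gy // rmorph0 !mulr0.
rewrite big1 // => x /eqP gx; rewrite graded ?rmorph0 ?mulr0 //.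
by rewrite gx eq_sym gy.
Qed.

(** The support has weight at most the sector dimension on either side: on the left since the
    columns of [U] are unit vectors, on the right by [schmidt_weight] and [bessel]. *)
Lemma support_weight k :
  \sum_(i | 0 < lam i) \sum_(x | gA x == k) sqn (U i x) <=
  (minn #|[set x | gA x == k]| #|[set y | gB y == k]|)%:R.
Proof.
rewrite natr_min le_min; apply/andP; split.
  rewrite exchange_big /= cardsE -sum1_card natr_sum; apply: ler_sum => x _.
  rewrite -(sum_U_col x) [leRHS](bigID (fun i => 0 < lam i)) /= lerDl.
  by apply: sumr_ge0 => *; apply: sqn_ge0.
rewrite cardsE -sum1_card natr_sum.
apply: le_trans (_ : \sum_(y | gB y == k) \sum_(i | 0 < lam i) sqn (V i y) / lam i <= _).
  rewrite [leRHS]exchange_big /=; apply: ler_sum => i li.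
  by rewrite -mulr_suml -schmidt_weight mulrC mulKf // gt_eqF.
by apply: ler_sum => y _; apply: bessel.
Qed.

(** Klein's inequality: [klein_scalar] for each pair of an eigenvalue and a basis vector, averaged
    with the doubly stochastic weights [sqn (U i x)]. The linear terms add up to at most - 1 + 1. *)
Lemma graded_entropy_le (m : nat) (q : nat -> R) :
  \tr rho = 1 -> (forall k, 0 <= q k) ->
  (forall x, (gA x < m)%N) -> (forall x, 0 < q (gA x)) ->
  \sum_(k < m) q k * (minn #|[set x | gA x == k]| #|[set y | gB y == k]|)%:R <= 1 ->
  vn_entropy rho <= - \sum_x complex.Re (rho x x) * ln (q (gA x)).
Proof.
move=> tr1 q0 gm qx hq; rewrite vn_entropyE.
have trl : \sum_i lam i = 1.
  apply: realC_inj; rewrite realC_sum [RHS]rmorph1 -tr1 {1}rho_spectral -mulmxA mxtrace_mulC -mulmxA UUt mulmx1.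
  by rewrite mxtrace_diag; apply: eq_bigr => i _; rewrite spectral_lam.
have -> : - \sum_i lam i * ln (lam i) = \sum_i \sum_x sqn (U i x) * - (lam i * ln (lam i)).
  rewrite -sumrN; apply: eq_bigr => i _.
  by rewrite -mulr_suml sum_U_row mul1r.
apply: (@le_trans _ _ (\sum_i \sum_x (sqn (U i x) * (- lam i * ln (q (gA x)))
    + sqn (U i x) * - lam i + sqn (U i x) * (q (gA x) * (0 < lam i)%R%:R)))).
  apply: ler_sum => i _; apply: ler_sum => x _; rewrite -!mulrDr.
  by apply: ler_wpM2l; rewrite ?sqn_ge0 // klein_scalar // lam_ge0.
under eq_bigr => i _ do rewrite !big_split /=.
rewrite !big_split /=.
have -> : \sum_i \sum_x sqn (U i x) * (- lam i * ln (q (gA x))) =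
    - \sum_x complex.Re (rho x x) * ln (q (gA x)).
  rewrite exchange_big -sumrN; apply: eq_bigr => x _ /=.
  rewrite rho_diagE /= mulr_suml -sumrN; apply: eq_bigr => i _; ring.
have -> : \sum_i \sum_x sqn (U i x) * - lam i = - 1.
  rewrite -trl -sumrN; apply: eq_bigr => i _.
  by rewrite -mulr_suml sum_U_row mul1r.
rewrite -addrA -[leRHS]addr0 lerD2l addrC subr_le0; apply: le_trans hq.
have -> : \sum_i \sum_x sqn (U i x) * (q (gA x) * (0 < lam i)%R%:R) =
   \sum_(k < m) q k * \sum_(i | 0 < lam i) \sum_(x | gA x == k) sqn (U i x).
  rewrite exchange_big /= (partition_big (fun x => Ordinal (gm x)) predT) //=.
  apply: eq_bigr => k _; rewrite [in RHS]exchange_big /= mulr_sumr.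
  apply: eq_big => [x|x /eqP <-]; first by rewrite -val_eqE.
  rewrite /= [in RHS]big_mkcond /= mulr_sumr; apply: eq_bigr => i _.
  by case: ifP => _; rewrite ?mulr0 // mulr1 mulrC.
by apply: ler_sum => k _; apply: ler_wpM2l => //; apply: support_weight.
Qed.

End PureState.
End Entropy.

(** * Unitary evolution *)

Section Exponential.
Import numFieldNormedType.Exports.

Lemma expr_similar_diag (K : numFieldType) d (P Q : 'M[K]_d) (D : 'rV[K]_d) k :
  P *m Q = 1%:M -> Q *m P = 1%:M ->
  (Q *m diag_mx D *m P) ^+ k = Q *m diag_mx (\row_i D 0 i ^+ k) *m P.
Proof.
move=> PQ QP; elim: k => [|k IH].
  rewrite expr0; have -> : diag_mx (\row_i D 0 i ^+ 0) = 1%:M.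
    apply/matrixP => i j; rewrite !mxE; case: eqP => //= _.
  by rewrite mulmx1 QP.
rewrite exprS IH -mulmxE !mulmxA -[Q *m _ *m P *m Q]mulmxA PQ mulmx1.
rewrite -[Q *m _ *m diag_mx _]mulmxA mulmx_diag.
by congr (_ *m diag_mx _ *m _); apply/rowP => i; rewrite !mxE exprS.
Qed.

Lemma similar_comm (K : numFieldType) d (P Q A B : 'M[K]_d) :
  P *m Q = 1%:M -> A *m B = B *m A ->
  (Q *m A *m P) *m (Q *m B *m P) = (Q *m B *m P) *m (Q *m A *m P).
Proof.
move=> PQ AB.
have e (X Y : 'M[K]_d) : (Q *m X *m P) *m (Q *m Y *m P) = Q *m (X *m Y) *m P.
  by rewrite !mulmxA -[Q *m X *m P *m Q]mulmxA PQ mulmx1.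
by rewrite !e AB.
Qed.

Lemma expmx_similar_diag (K : numFieldType) d (P Q : 'M[K]_d) (D e : 'rV[K]_d) :
  P *m Q = 1%:M -> Q *m P = 1%:M ->
  (forall i (eps : K), 0 < eps -> exists n0, forall n, (n0 <= n)%N ->
     `|e 0 i - \sum_(0 <= k < n) k`!%:R^-1 * D 0 i ^+ k| < eps) ->
  expmx (Q *m diag_mx D *m P) = Q *m diag_mx e *m P.
Proof.
move=> PQ QP he; apply: cvg_lim; first exact: norm_hausdorff.
apply/cvgrPdist_lt => eps eps0.
(* An error below eps / B for every eigenvalue becomes one below eps in every entry; the 1 keeps [B]
   positive and the last inequality strict. *)
pose B := 1 + \sum_x \sum_y \sum_i `|Q x i| * `|P i y|.
have B1 : 0 < B.
  rewrite ltr_wpDr //; do 3 (apply: sumr_ge0 => ? _).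
  by rewrite mulr_ge0.
have hi (i : 'I_d) : exists n0, forall n, (n0 <= n)%N ->
     `|e 0 i - \sum_(0 <= k < n) k`!%:R^-1 * D 0 i ^+ k| < eps / B.
  by apply: he; rewrite divr_gt0.
have [n0 hn0] := boolp.choice hi.
exists (\max_i n0 i)%N => // n /= hn.
have {hn0} hd i : `|e 0 i - \sum_(0 <= k < n) k`!%:R^-1 * D 0 i ^+ k| < eps / B.
  by apply: hn0; apply: leq_trans hn; exact: leq_bigmax.
have ent x y : (Q *m diag_mx e *m P - series (fun k => k`!%:R^-1 *: (Q *m diag_mx D *m P) ^+ k) n) x y
   = \sum_i Q x i * (e 0 i - \sum_(0 <= k < n) k`!%:R^-1 * D 0 i ^+ k) * P i y.
  rewrite !mxE /series /= summxE.
  under [X in _ - X]eq_bigr => k _ do rewrite expr_similar_diag // mxE mxE.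
  rewrite [X in _ - X](_ : _ = \sum_i \sum_(0 <= k < n) Q x i * (k`!%:R^-1 * D 0 i ^+ k) * P i y).
    rewrite -sumrB; apply: eq_bigr => i _.
    by rewrite mul_mx_diag mxE mulrBr mulrBl mulr_sumr mulr_suml.
  rewrite exchange_big /=; apply: eq_bigr => k _; rewrite mulr_sumr; apply: eq_bigr => i _.
  by rewrite mul_mx_diag !mxE; ring.
rewrite [X in X < _](_ : _ = mx_norm (Q *m diag_mx e *m P - series (fun k => k`!%:R^-1 *: (Q *m diag_mx D *m P) ^+ k) n)) //.
(* The matrix norm is the largest modulus of an entry, so a nonzero norm is attained at some (x,
   y). *)
have [->//|/mx_norm_neq0[[x y] /= ->]] := eqVneq (mx_norm (Q *m diag_mx e *m P - series (fun k => k`!%:R^-1 *: (Q *m diag_mx D *m P) ^+ k) n)) 0.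
rewrite ent; apply: le_lt_trans (ler_norm_sum _ _ _) _.
apply: (@le_lt_trans _ _ ((\sum_i `|Q x i| * `|P i y|) * (eps / B))).
  rewrite mulr_suml; apply: ler_sum => i _.
  by rewrite !normrM -mulrA [X in _ * X]mulrC mulrA ler_wpM2l ?mulr_ge0 // ltW.
rewrite mulrA ltr_pdivrMr // mulrC ltr_pM2l //.
have h : 0 <= \sum_(i | i != y) \sum_i0 `|Q x i0| * `|P i0 i|.
  by do 2 (apply: sumr_ge0 => ? _); rewrite mulr_ge0.
have h' : 0 <= \sum_(i | i != x) \sum_y \sum_i0 `|Q i i0| * `|P i0 y|.
  by do 3 (apply: sumr_ge0 => ? _); rewrite mulr_ge0.
rewrite /B; apply: (@le_lt_trans _ _ (\sum_x \sum_y \sum_i `|Q x i| * `|P i y|)).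
  by rewrite [leRHS](bigD1 x) //= [X in _ <= X + _](bigD1 y) //= -addrA lerDl addr_ge0.
by rewrite ltrDr.
Qed.

(** * The exponential of a Hermitian matrix *)

Section Unitary.
Local Open Scope complex_scope.
Local Open Scope sesquilinear_scope.
Local Open Scope classical_set_scope.
Variable R : realType.
Local Notation C := R[i].

Definition expi (x : R) : C := cos x +i* sin x.

Lemma expi_conj x : Num.conj (expi x) = expi (- x).
Proof. by rewrite /expi cosN sinN. Qed.

Lemma expi_unit x : expi x * Num.conj (expi x) = 1.
Proof.
rewrite expi_conj /expi cosN sinN; simpc; congr (_ +i* _).
  by rewrite -(cos2Dsin2 x); ring.
by ring.
Qed.

Lemma expi_coeff (x : R) k :
  k`!%:R^-1 * ('i * x%:C) ^+ k = cos_coeff x k +i* sin_coeff x k :> C.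
Proof.
rewrite exprMn -rmorphXn /=.
have -> : k`!%:R^-1 = (k`!%:R^-1)%:C :> C by rewrite fmorphV rmorph_nat.
rewrite /cos_coeff /sin_coeff /=.
have e2 : 'i ^+ 2 = -1 :> C := sqrCi _.
have -> : 'i ^+ k = 'i ^+ odd k * (-1) ^+ k./2 :> C.
  by rewrite -{1}(odd_double_half k) exprD -muln2 mulnC exprM e2.
case ok: (odd k) => /=; rewrite ?mul1r ?mul0r.
  have -> : k.-1./2 = k./2.
    by rewrite -{1}(odd_double_half k) ok /= doubleK.
  rewrite expr1 -(signr_odd C) -(signr_odd R); case: (odd _); rewrite ?expr0 ?expr1; simpc;
  congr (_ +i* _); ring.
have -> : exprz (-1) (Posz k./2) = (-1) ^+ odd k./2 :> R by rewrite signr_odd.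
rewrite -(signr_odd C).
case: (odd _); rewrite ?expr0 ?expr1; simpc; congr (_ +i* _); ring.
Qed.

Lemma cvg_expi (x : R) (eps : C) : 0 < eps -> exists n0, forall n, (n0 <= n)%N ->
  `|expi x - \sum_(0 <= k < n) k`!%:R^-1 * ('i * x%:C) ^+ k| < eps.
Proof.
move=> eps0.
have [r r0 er] : exists2 r : R, 0 < r & eps = r%:C.
  case: eps eps0 => a b; rewrite ltcE /= => /andP[/eqP -> a0].
  by exists a.
have r2 : 0 < r / 2 by rewrite divr_gt0.
have hc : series (cos_coeff x) @ \oo --> cos x.
  by rewrite cos.unlock; exact: is_cvg_series_cos_coeff.
have hs : series (sin_coeff x) @ \oo --> sin x.
  by rewrite sin.unlock; exact: is_cvg_series_sin_coeff.
move/cvgrPdist_lt/(_ _ r2) : hc => [n1 _ h1].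
move/cvgrPdist_lt/(_ _ r2) : hs => [n2 _ h2].
exists (maxn n1 n2) => n; rewrite geq_max => /andP[hn1 hn2].
have {}h1 := h1 n hn1; have {}h2 := h2 n hn2.
under eq_bigr => k _ do rewrite expi_coeff.
have -> : \sum_(0 <= k < n) (cos_coeff x k +i* sin_coeff x k) =
   (series (cos_coeff x) n +i* series (sin_coeff x) n) :> C.
  rewrite /series /=; elim/big_rec3: _ => //= k a b c _ ->.
  by simpc.
set u := _ - _.
have -> : u = (cos x - series (cos_coeff x) n)%:C + 'i * (sin x - series (sin_coeff x) n)%:C.
  by rewrite /u /expi; simpc.
apply: le_lt_trans (ler_normD _ _) _.
rewrite normrM normCi mul1r !normc_def /= !expr0n !addr0 !sqrtr_sqr er -rmorphD /= ltcR.
by rewrite (splitr r); apply: ltrD.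
Qed.

(** Diagonalization reduces the exponential to the phases of the real eigenvalues. The last clause
    is how a conserved quantity of [H] passes to the evolution. *)
Lemma herm_expmx d (H : 'M[C]_d) (t : R) : H \is hermsymmx ->
  exists V : 'M[C]_d, [/\ expmx (- ('i * t%:C) *: H) = V,
    expmx (('i * t%:C) *: H) = V ^t*, V *m V ^t* = 1%:M &
    forall N : 'M[C]_d, N *m H = H *m N -> N *m V = V *m N].
Proof.
move=> hH.
have nH := hermitian_normalmx hH.
have eH := orthomx_spectralP nH.
set P := spectralmx H in eH; set D := spectral_diag H in eH.
have PU : P \is unitarymx by apply: spectral_unitarymx.
rewrite invmx_unitary // in eH.
have PPt : P *m P ^t* = 1%:M by apply/unitarymxP.
have PtP : P ^t* *m P = 1%:M by apply: mulmx1C.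
pose th i : R := complex.Re (D 0 i).
have Dreal i : D 0 i = (th i)%:C.
  have /mxOverP/(_ 0 i) := hermitian_spectral_diag_real hH.
  by rewrite -/D /th => /RRe_real.
pose E s : 'rV[C]_d := \row_i expi (s * t * th i).
have key (s : R) : expmx ((s%:C * ('i * t%:C)) *: H) = P ^t* *m diag_mx (E s) *m P.
  rewrite [in LHS]eH scalemxAl scalemxAr.
  have -> : (s%:C * ('i * t%:C)) *: diag_mx D = diag_mx (\row_i ('i * (s * t * th i)%:C)).
    apply/matrixP => i j; rewrite !mxE Dreal mulrnAr.
    by congr (_ *+ _); rewrite !rmorphM /=; ring.
  apply: expmx_similar_diag => // i eps eps0.
  rewrite !mxE; exact: cvg_expi.
exists (P ^t* *m diag_mx (E (-1)) *m P); split.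
- by rewrite -(key (-1)) (_ : (-1)%:C * _ = - ('i * t%:C)) // rmorphN rmorph1 mulN1r.
- have := key 1; rewrite rmorph1 mul1r => ->.
  rewrite !trmx_mul !map_mxM trmxCK -mulmxA; congr (_ *m (_ *m _)).
  apply/matrixP => i j; rewrite !mxE eq_sym; case: eqP => [->|_]; last by rewrite !mulr0n rmorph0.
  rewrite !mulr1n; transitivity (Num.conj (expi (-1 * t * th i))); last by [].
  by rewrite expi_conj; congr expi; ring.
- rewrite !trmx_mul !map_mxM trmxCK !mulmxA -[_ *m P *m P ^t*]mulmxA PPt mulmx1.
  rewrite -[P ^t* *m _ *m _]mulmxA.
  suff -> : diag_mx (E (-1)) *m (diag_mx (E (-1))) ^t* = 1%:M by rewrite mulmx1.
  apply/matrixP => i j; rewrite mul_diag_mx !mxE eq_sym.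
  case: eqP => [->|_]; last by rewrite mulr0n rmorph0 mulr0.
  rewrite !mulr1n; exact: expi_unit.
move=> N NH.
pose M := P *m N *m P ^t*.
have MD : M *m diag_mx D = diag_mx D *m M.
  have eD : diag_mx D = P *m H *m P ^t*.
    by rewrite eH !mulmxA PPt mul1mx -mulmxA PPt mulmx1.
  rewrite eD /M !mulmxA -[P *m N *m _ *m P]mulmxA PtP mulmx1.
  rewrite -[P *m N *m H]mulmxA NH.
  by rewrite -[P *m H *m _ *m P]mulmxA PtP mulmx1 !mulmxA.
(* In the eigenbasis of [H], an entry of [M] vanishes unless its two eigenvalues agree, and equal
   eigenvalues have equal phases. *)
have ME : M *m diag_mx (E (-1)) = diag_mx (E (-1)) *m M.
  apply/matrixP => i j; have /matrixP/(_ i j) := MD.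
  rewrite !mul_mx_diag !mul_diag_mx !mxE.
  have [->|ne] := eqVneq (th i) (th j); first by move=> _; rewrite mulrC.
  rewrite !Dreal mulrC => /eqP; rewrite -subr_eq0 -mulrBl mulf_eq0 subr_eq0.
  case/orP => [/eqP[]e|/eqP ->]; last by rewrite mulr0 mul0r.
  by rewrite e eqxx in ne.
have eN : N = P ^t* *m M *m P.
  by rewrite /M !mulmxA PtP mul1mx -mulmxA PtP mulmx1.
rewrite eN; exact: similar_comm.
Qed.

End Unitary.

End Exponential.

(** * Fock space *)

Section FockFacts.
Import finset.
Local Open Scope complex_scope.
Local Open Scope sesquilinear_scope.
Variable R : realType.
Local Notation C := R[i].
Local Notation rk S := (enum_rank (S : {set 'I__}) : 'I_(fock_dim _)).

Section Grading.
Variable N : nat.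
Implicit Types (A B : 'M[C]_(fock_dim N)).

(* A changes the particle number by p - q. *)
Definition shifts (p q : nat) A :=
  forall S T : {set 'I_N}, (#|S| + q)%N != (#|T| + p)%N -> A (rk S) (rk T) = 0.

Lemma shiftsM p q p' q' A B : shifts p q A -> shifts p' q' B ->
  shifts (p + p') (q + q') (A *m B).
Proof.
move=> hA hB S T h; rewrite mxE fock_sum big1 // => Z _.
have [e|ne] := eqVneq (#|S| + q)%N (#|Z| + p)%N; last by rewrite hA // mul0r.
rewrite hB ?mulr0 //; apply: contra_neq h => e'; lia.
Qed.

Lemma shiftsD p q A B : shifts p q A -> shifts p q B -> shifts p q (A + B).
Proof. by move=> hA hB S T h; rewrite mxE hA // hB // addr0. Qed.

Lemma shifts0 p q : shifts p q 0.
Proof. by move=> S T _; rewrite mxE. Qed.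

Lemma shiftsZ p q c A : shifts p q A -> shifts p q (c *: A).
Proof. by move=> hA S T h; rewrite mxE hA // mulr0. Qed.

Lemma shifts_sum p q (I : finType) (P : pred I) (F : I -> 'M[C]_(fock_dim N)) :
  (forall i, shifts p q (F i)) -> shifts p q (\sum_(i | P i) F i).
Proof.
move=> h; elim/big_rec: _ => [|i A _ hA]; first exact: shifts0.
exact: shiftsD.
Qed.

Lemma shifts_adj p q A : shifts p q A -> shifts q p (A ^t*).
Proof. by move=> hA S T h; rewrite adjmxE hA ?rmorph0 // eq_sym. Qed.

Lemma shifts_annih (j : 'I_N) : shifts 0 1 (annih R j).
Proof.
move=> S T h; rewrite annihE; case: ifP => // /andP[jT /eqP eS].
by move: h; rewrite eS (finset.cardsD1 j T) jT addn0 addnC eqxx.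
Qed.

Lemma shifts_creat (j : 'I_N) : shifts 1 0 (creat R j).
Proof. exact/shifts_adj/shifts_annih. Qed.

Lemma shifts_offset p q A : shifts (p + q) (p + q) A -> shifts 0 0 A.
Proof. by move=> hA S T h; apply: hA; rewrite eqn_add2r; move: h; rewrite !addn0. Qed.

Lemma hamiltonian_number eps1 eps2 (h : 'M[C]_N) J :
  shifts 0 0 (hamiltonian eps1 eps2 h J).
Proof.
have hn (j k : 'I_N) : shifts 0 0 (creat R j *m annih R k).
  by apply: (@shifts_offset 1 0); apply: shiftsM (shifts_creat j) (shifts_annih k).
have h4 : shifts 0 0 (SYK4_half J).
  do 4 (apply: shifts_sum => ?).
  apply: shiftsZ; apply: (@shifts_offset 2 0).
  have h2 := shiftsM (shiftsM (shiftsM (shifts_creat _) (shifts_creat _)) (shifts_annih _)) (shifts_annih _).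
  exact: h2.
apply: shiftsD; first apply: shiftsD.
- by apply: shifts_sum => j.
- by apply: shiftsZ; do 2 (apply: shifts_sum => ?); apply: shiftsZ.
- apply: shiftsZ; apply: shiftsD => //; exact: shifts_adj.
Qed.

Definition particle_number : 'M[C]_(fock_dim N) :=
  diag_mx (\row_x (#|(enum_val x : {set 'I_N})|)%:R).

(** Number conservation as a commutation relation, the form in which [herm_expmx] transports it. *)
Lemma shifts_comm A : shifts 0 0 A <-> particle_number *m A = A *m particle_number.
Proof.
split=> [hA|cA].
  apply: fock_mxP => S T; rewrite mul_diag_mx mul_mx_diag !mxE !enum_rankK.
  have [->|ne] := eqVneq #|S| #|T|; first by rewrite mulrC.
  by rewrite hA ?mulr0 ?mul0r // !addn0.
move=> S T; rewrite !addn0 => ne.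
have /matrixP/(_ (rk S) (rk T)) := cA.
rewrite mul_diag_mx mul_mx_diag !mxE !enum_rankK mulrC => /eqP.
rewrite -subr_eq0 -mulrBr mulf_eq0 subr_eq0 eqr_nat (negbTE ne) orbF.
by move/eqP.
Qed.

Lemma adjmxD A B : (A + B) ^t* = A ^t* + B ^t*.
Proof. by apply/matrixP => x y; rewrite !mxE rmorphD. Qed.

Lemma adjmxZ c A : (c *: A) ^t* = Num.conj c *: A ^t*.
Proof. by apply/matrixP => x y; rewrite !mxE rmorphM. Qed.

Lemma adjmxM A B : (A *m B) ^t* = B ^t* *m A ^t*.
Proof. by rewrite trmx_mul map_mxM. Qed.

Lemma adjmx_sum (I : finType) (P : pred I) (F : I -> 'M[C]_(fock_dim N)) :
  (\sum_(i | P i) F i) ^t* = \sum_(i | P i) (F i) ^t*.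
Proof.
apply: (big_morph (fun A : 'M[C]_(fock_dim N) => A ^t*) adjmxD).
by apply/matrixP => x y; rewrite !mxE rmorph0.
Qed.

Lemma hamiltonian_herm eps1 eps2 (h : 'M[C]_N) J : h \is hermsymmx ->
  hamiltonian eps1 eps2 h J \is hermsymmx.
Proof.
move=> hh.
have hjk j k : Num.conj (h j k) = h k j.
  by have /is_hermitianmxP := hh; rewrite expr0 scale1r => /matrixP/(_ k j); rewrite !mxE.
apply/is_hermitianmxP; rewrite expr0 scale1r /hamiltonian !adjmxD !adjmxZ.
have conjR (x : R) : Num.conj (x%:C) = x%:C :> C by exact: conjc_real.
rewrite !conjR; congr (_ + _ *: _ + _ *: _).
- rewrite /number_op adjmx_sum; apply: eq_bigr => j _.
  by rewrite adjmxM /creat trmxCK.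
- rewrite /H_SYK2 adjmx_sum exchange_big /=; apply: eq_bigr => j _.
  rewrite adjmx_sum; apply: eq_bigr => k _.
  by rewrite adjmxZ adjmxM /creat trmxCK hjk.
- by rewrite /H_SYK4 adjmxD trmxCK addrC.
Qed.

Lemma creat_basis (j : 'I_N) (T : {set 'I_N}) : j \notin T ->
  exists2 s : C, s * Num.conj s = 1 &
  creat R j *m delta_mx (rk T) 0 = s *: delta_mx (rk (j |: T)) (0 : 'I_1).
Proof.
move=> jT; exists ((-1) ^+ #|[set k in j |: T | (k < j)%N]|).
  by rewrite rmorph_sign -expr2 sqrr_sign.
apply/matrixP => x y; rewrite -colE [LHS]mxE -[x]enum_valK creatE !mxE.
rewrite (inj_eq enum_rank_inj) [y]ord1 eqxx andbT.
case: (boolP (j \in enum_val x)) => jx /=.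
  have -> : (T == enum_val x :\ j) = (enum_val x == j |: T).
    by rewrite -{1}(finset.setU1K jT) eq_setD1 ?finset.setU11 // eq_sym.
  by case: eqP => [->|_]; rewrite ?mulr1 ?mulr0.
case: eqP => [e|_]; last by rewrite mulr0.
by rewrite e finset.setU11 in jx.
Qed.

Lemma slater_basis (S : {set 'I_N}) :
  exists2 s : C, s * Num.conj s = 1 & slater R S = s *: delta_mx (rk S) 0.
Proof.
rewrite /slater /vacuum -big_filter.
have : uniq [seq j <- index_enum 'I_N | j \in S] by rewrite filter_uniq // index_enum_uniq.
have : S = [set j in [seq j <- index_enum 'I_N | j \in S]].
  by apply/finset.setP => j; rewrite inE mem_filter mem_index_enum andbT.
move: [seq _ <- _ | _] => l; elim: l S => [|j l IH] S.
  move=> eS _; exists 1; first by rewrite rmorph1 mulr1.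
  rewrite big_nil scale1r mul1mx; suff -> : S = finset.set0 by [].
  by rewrite eS; apply/finset.setP => j; rewrite !inE.
move=> eS /= /andP[jl ul].
have [s s1 es] := IH [set j in l] erefl ul.
have jT : j \notin [set j in l] by rewrite inE.
have [s' s1' es'] := creat_basis jT.
exists (s' * s); first by rewrite rmorphM mulrACA s1 s1' mulr1.
rewrite big_cons -mulmxE -mulmxA es -scalemxAr es' scalerA mulrC.
suff -> : S = j |: [set j in l] by [].
by rewrite eS; apply/finset.setP => k; rewrite !inE.
Qed.

End Grading.

(** * Schmidt matrix of a pure state *)

Section Reduction.
Variables (N : nat) (A : {set 'I_N}).

Definition outer_set (Z : {set 'I_N}) := Z :&: A == finset.set0.

(** Columns range over all sets of modes and vanish unless the set avoids [A], which spares a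
    separate Fock space for the complement. The sign undoes the reordering of the modes. *)
Definition schmidt_mx (phi : 'cV[C]_(fock_dim N)) : 'M[C]_(fock_dim #|A|, fock_dim N) :=
  \matrix_(x, z) if outer_set (enum_val z)
    then jw_sign R A (Defs.glue (enum_val x : {set 'I_#|A|}) (enum_val z)) * phi (rk (Defs.glue (enum_val x : {set 'I_#|A|}) (enum_val z : {set 'I_N}))) 0
    else 0.

Lemma schmidt_mxE phi (S : {set 'I_#|A|}) (Z : {set 'I_N}) : schmidt_mx phi (rk S) (rk Z) =
  if outer_set Z then jw_sign R A (Defs.glue S Z) * phi (rk (Defs.glue S Z)) 0 else 0.
Proof. by rewrite mxE !enum_rankK. Qed.

Lemma outer_setD Z : outer_set Z -> Z :\: A = Z.
Proof. by rewrite /outer_set finset.setI_eq0 => /finset.setDidPl. Qed.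

Lemma glue_sum (V : nmodType) (F : {set 'I_N} -> V) :
  \sum_X F X = \sum_(Z | outer_set Z) \sum_S F (Defs.glue (A := A) S Z).
Proof.
rewrite (partition_big (fun X => X :\: A) outer_set) /=; last first.
  by move=> X _; rewrite /outer_set finset.setIDAC finset.setDIl finset.setDv finset.setI0.
apply: eq_bigr => Z hZ.
rewrite (reindex_onto (fun S => Defs.glue S Z) (inner A)) /=.
  apply: eq_bigl => S; rewrite glue_outer glueK outer_setD // !eqxx //.
move=> X /eqP e; rewrite -{2}(innerK A X); rewrite /Defs.glue -e.
by rewrite finset.setDDl finset.setUid.
Qed.

(** By uniqueness it is enough to compare traces against [embed_op B], which is diagonal in the
    modes outside [A]. *)
Lemma reduced_pure phi : reduced A (phi *m phi ^t*) = schmidt_mx phi *m (schmidt_mx phi) ^t*.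
Proof.
suff red : is_reduced (A := A) (phi *m phi ^t*) (schmidt_mx phi *m (schmidt_mx phi) ^t*).
  exact: (reduced_unique (@reducedP R N A _) red).
move=> B B' /local_opE ->.
rewrite -mulmxA mxtrace_mulC -[in RHS]mulmxA [in RHS]mxtrace_mulC.
rewrite /mxtrace fock_sum big_ord_recl big_ord0 addr0.
transitivity (\sum_(Z | outer_set Z) \sum_T \sum_S
  Num.conj (schmidt_mx phi (rk T) (rk Z)) * B (rk T) (rk S) * schmidt_mx phi (rk S) (rk Z)).
  rewrite [RHS]big_mkcond /=; apply: eq_bigr => Z _.
  rewrite mxE fock_sum; case: ifP => hZ; last first.
    rewrite big1 // => S _.
    by rewrite schmidt_mxE hZ mulr0.
  rewrite exchange_big /=; apply: eq_bigr => S _.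
  by rewrite mxE fock_sum mulr_suml; apply: eq_bigr => T _; rewrite adjmxE.
rewrite mxE fock_sum (glue_sum (fun X => _)) /=; apply: eq_bigr => Z hZ.
rewrite exchange_big /=; apply: eq_bigr => S _.
rewrite [X in _ = X * _]mxE fock_sum (glue_sum (fun X => _)) /= mulr_suml (bigD1 Z) //= [X in _ = _ + X]big1 ?addr0.
  rewrite mulr_suml; apply: eq_bigr => T _.
  rewrite adjmxE embed_opE !glue_outer eqxx !glueK !schmidt_mxE hZ rmorphM /= jw_sign_conj.
  by ring.
move=> Z' /andP[hZ' ne]; rewrite mulr_suml big1 // => T _.
by rewrite embed_opE !glue_outer !outer_setD // (negbTE ne) mulr0 mul0r.
Qed.

Lemma card_glue S Z : outer_set Z -> #|Defs.glue (A := A) S Z| = (#|S| + #|Z|)%N.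
Proof.
move=> hZ; rewrite /Defs.glue outer_setD // finset.cardsU.
rewrite card_imset; last exact: enum_val_inj.
suff -> : [set enum_val i | i in S] :&: Z = finset.set0 by rewrite finset.cards0 subn0.
apply/finset.setP => j; rewrite !inE; apply/negP => /andP[/finset.imsetP[i _ ->] jZ].
move/eqP/finset.setP/(_ (enum_val i)): hZ; rewrite !inE jZ /= enum_valP //.
Qed.

Lemma card_outer_sets k :
  #|[set Z | outer_set Z && (#|Z| == k)]| = 'C(N - #|A|, k).
Proof.
have -> : [set Z | outer_set Z && (#|Z| == k)] = [set Z : {set 'I_N} | Z \subset ~: A & #|Z| == k].
  by apply/finset.setP => Z; rewrite !inE /outer_set finset.setI_eq0 finset.disjoints_subset.
by rewrite cards_draws finset.cardsCs finset.setCK card_ord.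
Qed.

End Reduction.
End FockFacts.

(** * Entropy averaged over the initial states *)

Section AverageEntropy.
Import finset.
Local Open Scope complex_scope.
Local Open Scope sesquilinear_scope.
Variable R : realType.
Local Notation C := R[i].
Local Notation rk S := (enum_rank (S : {set 'I__}) : 'I_(fock_dim _)).

Lemma sum_ord_support (a b : nat) (G : nat -> R) :
  (forall k, (a <= k)%N -> G k = 0) -> (forall k, (b <= k)%N -> G k = 0) ->
  \sum_(k < a) G k = \sum_(k < b) G k.
Proof.
wlog ab : a b / (a <= b)%N.
  by move=> h ha hb; case/orP: (leq_total a b) => ab; [|symmetry]; apply: h.
move=> ha _; rewrite (big_ord_widen _ _ ab) big_mkcond /=; apply: eq_bigr => k _.
by case: ltnP => // /ha.
Qed.

Lemma card_sets_ord L k : #|[set T : {set 'I_L} | #|T| == k]| = 'C(L, k).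
Proof. by rewrite card_draws card_ord. Qed.

Lemma sum_set_card (L : nat) (G : nat -> R) :
  \sum_(T : {set 'I_L}) G #|T| = \sum_(k < L.+1) 'C(L, k)%:R * G k.
Proof.
have TL (T : {set 'I_L}) : (#|T| < L.+1)%N by rewrite ltnS -[X in (_ <= X)%N](card_ord L) max_card.
rewrite (partition_big (fun T : {set 'I_L} => Ordinal (TL T)) predT) //=.
apply: eq_bigr => k _; rewrite (eq_bigr (fun=> G k)); last by move=> T /eqP <-.
rewrite sumr_const -[LHS]mulr_natl; congr (_ * _); congr (_%:R).
by rewrite -card_sets_ord cardsE; apply: eq_card.
Qed.

Lemma sqnM (z w : C) : sqn (z * w) = sqn z * sqn w.
Proof. by case: z w => [a b] [c d]; rewrite /sqn /=; ring. Qed.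

Lemma sqn_unit (s : C) : s * Num.conj s = 1 -> sqn s = 1.
Proof. by rewrite -sqnE => /realC_inj. Qed.

Lemma sqn_jw_sign N (A X : {set 'I_N}) : sqn (jw_sign R A X) = 1.
Proof. by apply: sqn_unit; rewrite jw_sign_conj jw_signK. Qed.

Lemma card_fock (N : nat) (P : pred {set 'I_N}) :
  #|[set x : 'I_(fock_dim N) | P (enum_val x)]| = #|[set T | P T]|.
Proof.
rewrite -[RHS](card_imset _ enum_rank_inj); apply: eq_card => x.
rewrite inE; apply/idP/imsetP => [Px|[T]]; last by rewrite inE => PT ->; rewrite enum_rankK.
by exists (enum_val x); rewrite ?inE ?enum_valK.
Qed.

Section Evolution.
Variables (N n : nat) (A : {set 'I_N}) (V : 'M[C]_(fock_dim N)).
Hypothesis VVt : V *m V ^t* = 1%:M.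
Hypothesis VN : shifts 0 0 V.

Lemma sqn_evolved_slater (S X : {set 'I_N}) :
  sqn ((V *m slater R S) (rk X) 0) = sqn (V (rk X) (rk S)).
Proof.
have [s s1 ->] := slater_basis R S.
by rewrite -scalemxAr mxE -colE mxE sqnM sqn_unit // mul1r.
Qed.

(** Number conservation confines the row of [X] to sets of size [#|X|], and unitarity gives that row
    norm 1. This makes the averaged distribution independent of the dynamics. *)
Lemma sum_sqn_row (X : {set 'I_N}) :
  \sum_(S : {set 'I_N} | #|S| == n) sqn (V (rk X) (rk S)) = (#|X| == n)%:R.
Proof.
have z (S : {set 'I_N}) : #|X| != #|S| -> sqn (V (rk X) (rk S)) = 0.
  by move=> ne; rewrite VN ?sqn0 // !addn0.
case: eqP => [Xn|/eqP Xn]; last first.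
  by rewrite big1 // => S /eqP Sn; apply: z; rewrite Sn.
transitivity (\sum_S sqn (V (rk X) (rk S))).
  rewrite [RHS](bigID (fun S : {set 'I_N} => #|S| == n)) /= [X in _ = _ + X]big1 ?addr0 //.
  by move=> S Sn; apply: z; rewrite Xn eq_sym.
apply: realC_inj; rewrite realC_sum.
have := congr1 (fun M : 'M[C]__ => M (rk X) (rk X)) VVt.
rewrite /= mxE [RHS]mxE eqxx fock_sum => e; apply: etrans e.
by apply: eq_bigr => S _; rewrite adjmxE sqnE.
Qed.

Lemma sum_sqn_col (S : {set 'I_N}) : \sum_X sqn (V (rk X) (rk S)) = 1.
Proof.
apply: realC_inj; rewrite realC_sum.
have := congr1 (fun M : 'M[C]__ => M (rk S) (rk S)) (mulmx1C VVt).
rewrite /= mxE [RHS]mxE eqxx fock_sum => e; apply: etrans e.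
by apply: eq_bigr => X _; rewrite adjmxE sqnE mulrC.
Qed.

Let phi S := V *m slater R S.
Let rho S := schmidt_mx A (phi S) *m (schmidt_mx A (phi S)) ^t*.

Lemma reduced_diag S (T : {set 'I_#|A|}) : complex.Re (rho S (rk T) (rk T)) =
  \sum_(Z | outer_set A Z) sqn (V (rk (Defs.glue T Z)) (rk S)).
Proof.
rewrite rho_diag_sqn fock_sum [RHS]big_mkcond /=; apply: eq_bigr => Z _.
rewrite schmidt_mxE; case: ifP => _; last exact: sqn0.
by rewrite sqnM sqn_jw_sign mul1r sqn_evolved_slater.
Qed.

Lemma reduced_trace S : \tr (rho S) = 1.
Proof.
rewrite /mxtrace; transitivity ((\sum_x complex.Re (rho S x x))%:C).
  rewrite realC_sum; apply: eq_bigr => x _; rewrite rho_diag_sqn mxE realC_sum.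
  by apply: eq_bigr => y _; rewrite adjmxE sqnE.
rewrite fock_sum; under eq_bigr => T _ do rewrite reduced_diag.
rewrite exchange_big /= -(glue_sum A (fun X => sqn (V (rk X) (rk S)))) sum_sqn_col.
exact: rmorph1.
Qed.

(** The test is essential: for k > n truncated subtraction would give a binomial equal to 1. *)
Definition sector_dim (k : nat) : nat := if (k <= n)%N then 'C(N - #|A|, n - k) else 0.

Lemma card_sector (k : nat) :
  #|[set Z : {set 'I_N} | outer_set A Z && (k + #|Z| == n)%N]| = sector_dim k.
Proof.
rewrite /sector_dim; case: leqP => kn.
  rewrite -card_outer_sets; apply: eq_card => Z; rewrite !inE; congr (_ && _).
  by rewrite -[in LHS](subnKC kn) eqn_add2l.
apply: eq_card0 => Z; rewrite !inE; apply/negP => /andP[_ /eqP e]; lia.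
Qed.

Lemma average_diag (T : {set 'I_#|A|}) :
  \sum_(S : {set 'I_N} | #|S| == n) complex.Re (rho S (rk T) (rk T)) = (sector_dim #|T|)%:R.
Proof.
under eq_bigr => S _ do rewrite reduced_diag.
rewrite exchange_big /=; under eq_bigr => Z hZ do rewrite sum_sqn_row card_glue //.
rewrite -natr_sum; congr (_%:R); move: #|T| => k; rewrite -card_sector -sum1_card.
rewrite [in RHS]big_mkcond [in LHS]big_mkcond /=; apply: eq_bigr => Z _.
by rewrite inE; case: (outer_set _ _) => //=; case: eqP.
Qed.

Lemma sum_entropy_le (q : nat -> R) :
  (forall k, 0 <= q k) -> (forall k, (k <= #|A|)%N -> 0 < q k) ->
  \sum_(k < #|A|.+1) q k * (minn 'C(#|A|, k) (sector_dim k))%:R <= 1 ->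
  \sum_(S : {set 'I_N} | #|S| == n) vn_entropy (rho S) <=
  - \sum_(k < #|A|.+1) 'C(#|A|, k)%:R * ((sector_dim k)%:R * ln (q k)).
Proof.
move=> q0 q1 hq.
pose gA (x : 'I_(fock_dim #|A|)) := #|(enum_val x : {set 'I_#|A|})|.
(* The grade of a complement configuration is the number of particles it leaves for [A]. The dummy
   grade [#|A|.+1] puts the vanishing columns outside all sectors. *)
pose gB (z : 'I_(fock_dim N)) := let Z := (enum_val z : {set 'I_N}) in
  if outer_set A Z && (#|Z| <= n)%N then (n - #|Z|)%N else #|A|.+1.
have gAm x : (gA x < #|A|.+1)%N.
  by rewrite ltnS -[X in (_ <= X)%N](card_ord #|A|) max_card.
have step (S : {set 'I_N}) : #|S| == n ->
    vn_entropy (rho S) <= - \sum_x complex.Re (rho S x x) * ln (q (gA x)).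
  move=> /eqP Sn.
  apply: (@graded_entropy_le R _ _ (schmidt_mx A (phi S)) gA gB _ #|A|.+1) => //.
  - move=> x z; rewrite -[x]enum_valK -[z]enum_valK /gA /gB !enum_rankK schmidt_mxE.
    set T := enum_val x; set Z := enum_val z => ne.
    case: (boolP (outer_set A Z)) ne => // hZ /= ne.
    have [s _ es] := slater_basis R S.
    rewrite /phi es -scalemxAr mxE -colE mxE VN ?mulr0 ?mulr0 //.
    rewrite !addn0 Sn card_glue //.
    apply: contra_neq ne => e; have -> : (#|Z| <= n)%N by rewrite -e leq_addl.
    by rewrite -e addnK.
  - exact: reduced_trace.
  - by move=> x; apply: q1; rewrite -ltnS.
  apply: le_trans hq; rewrite le_eqVlt; apply/orP; left; apply/eqP.
  apply: eq_bigr => k _; congr (_ * (minn _ _)%:R).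
    by rewrite -card_sets_ord (card_fock (fun T : {set 'I_#|A|} => #|T| == k)).
  rewrite -card_sector (card_fock (fun Z : {set 'I_N} => (if outer_set A Z && (#|Z| <= n)%N
    then (n - #|Z|)%N else #|A|.+1) == k)).
  apply: eq_card => Z; rewrite !inE; have := ltn_ord k.
  move: (nat_of_ord k) => k'; move: (#|Z|) (#|A|.+1) => z a.
  by case: (outer_set A Z) => /=; case: (leqP z n) => zn; lia.
apply: le_trans (ler_sum _ step) _.
rewrite sumrN lerN2 exchange_big /= fock_sum.
rewrite -(sum_set_card #|A| (fun k => (sector_dim k)%:R * ln (q k))).
rewrite le_eqVlt; apply/orP; left; apply/eqP; apply: eq_bigr => T _.
by rewrite -mulr_suml average_diag /gA enum_rankK.
Qed.

End Evolution.

Lemma evolved_pure N (H V : 'M[C]_(fock_dim N)) (psi : 'cV[C]_(fock_dim N)) (t : R) :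
  expmx (- ('i * t%:C) *: H) = V -> expmx (('i * t%:C) *: H) = V ^t* ->
  evolved_state H psi t = (V *m psi) *m (V *m psi) ^t*.
Proof.
move=> e1 e2; rewrite /evolved_state e1 e2 trmx_mul map_mxM.
by rewrite !mulmxA.
Qed.

Lemma average_entropy_le (N n : nat) (A : {set 'I_N}) (eps1 eps2 : R) (h : 'M[C]_N)
    (J : 'I_N -> 'I_N -> 'I_N -> 'I_N -> C) (t : R) (q : nat -> R) :
  h \is hermsymmx ->
  (forall k, 0 <= q k) -> (forall k, (k <= #|A|)%N -> 0 < q k) ->
  \sum_(k < n.+1) q k * (minn 'C(#|A|, k) 'C(N - #|A|, n - k))%:R <= 1 ->
  \sum_(S : {set 'I_N} | #|S| == n)
     vn_entropy (reduced A (evolved_state (hamiltonian eps1 eps2 h J) (slater R S) t)) <=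
  - \sum_(k < n.+1) ('C(#|A|, k) * 'C(N - #|A|, n - k))%:R * ln (q k).
Proof.
move=> hh q0 q1 hq.
have [V [e1 e2 VVt Vcomm]] := herm_expmx t (hamiltonian_herm eps1 eps2 J hh).
have VN : shifts 0 0 V.
  by apply/shifts_comm/Vcomm; apply/shifts_comm; apply: hamiltonian_number.
under eq_bigr => S _ do rewrite (evolved_pure _ e1 e2) reduced_pure.
(* Sums over k <= #|A| and over k <= n agree, because the terms beyond either bound vanish. *)
have trunc (G : nat -> nat -> R) : (forall k, G k 0%N = 0) -> (forall k d, (#|A| < k)%N -> G k d = 0) ->
    \sum_(k < #|A|.+1) G k (sector_dim n A k) = \sum_(k < n.+1) G k ('C(N - #|A|, n - k)).
  move=> G0 GA; rewrite (@sum_ord_support #|A|.+1 n.+1 (fun k => G k (sector_dim n A k))).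
  - by apply: eq_bigr => k _; rewrite /sector_dim -ltnS ltn_ord.
  - by move=> k kA; apply: GA.
  - by move=> k; rewrite /sector_dim leqNgt => /negbTE; rewrite ltnS => ->.
apply: le_trans (sum_entropy_le (n := n) (A := A) VVt VN q0 q1 _) _.
  rewrite (trunc (fun k d => q k * (minn 'C(#|A|, k) d)%:R)) //.
    by move=> k; rewrite minn0 mulr0.
  by move=> k d kA; rewrite bin_small // min0n mulr0.
rewrite (trunc (fun k d => 'C(#|A|, k)%:R * (d%:R * ln (q k)))) //.
- by under eq_bigr do rewrite mulrA -natrM.
- by move=> k; rewrite mul0r mulr0.
- by move=> k d kA; rewrite bin_small // mul0r.
Qed.

End AverageEntropy.

(** * Page curve *)

Section PageBound.
Variable R : realType.

(** Passing to the limit logarithm costs at most 1 / n, and the factor n / (n + 1) a further l / n,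
    where l is that logarithm. Multiplied by a square root of at most sqrt L, with n = 2 nu L, both
    are of order 1 / sqrt L. *)
Lemma correction_le (nu : R) (N n L : nat) (T : R) : 0 < nu <= 1 / 2 ->
  (0 < n)%N -> (n <= L)%N -> N = L.*2 -> n%:R = nu * N%:R ->
  Num.sqrt (n%:R * (L.*2 - n)%:R / (4 * L%:R * pi)) * (n%:R / n.+1%:R) <= T ->
  `|ln ((1 - nu) / nu)| * Num.sqrt (nu * (1 - nu) * N%:R / (2 * pi)) <=
  T * ln ((L.*2 - n).+1%:R / n.+1%:R)
    + (1 + `|ln ((1 - nu) / nu)|) / nu / Num.sqrt L%:R.
Proof.
move=> /andP[nu0 nu2] n0 nL eN en.
have L0 : 0 < L%:R :> R by rewrite ltr0n; lia.
have n0' : 0 < n%:R :> R by rewrite ltr0n.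
have pi0 : 0 < pi :> R := pi_gt0 R.
have eL : N%:R = 2 * L%:R :> R by rewrite eN -mul2n natrM.
have enL : (L.*2 - n)%:R = (1 - nu) * N%:R :> R.
  by rewrite natrB; [rewrite -eN en; ring|lia].
have -> : n%:R * (L.*2 - n)%:R / (4 * L%:R * pi) = nu * (1 - nu) * N%:R / (2 * pi).
  rewrite enL en eL; move: (@pi R) pi0 => p p0.
  by field; rewrite !gt_eqF.
set tau := Num.sqrt (nu * (1 - nu) * N%:R / (2 * pi)).
set lq := ln ((L.*2 - n).+1%:R / n.+1%:R).
have l0 : 0 <= ln ((1 - nu) / nu) by apply: ln_ge0; rewrite ler_pdivlMr //; lra.
rewrite ger0_norm //; set l := ln ((1 - nu) / nu) in l0 *.
have nu1 : 0 < 1 - nu by lra.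
have r1 : n%:R / n.+1%:R = 1 - n.+1%:R^-1 :> R.
  by rewrite -[n.+1%:R]natr1; field; rewrite natr1 pnatr_eq0.
have lqge : l - n%:R^-1 <= lq.
  have h1 : ln (1 + n%:R^-1) <= n%:R^-1 :> R.
    by apply: le_ln1Dx; rewrite (lt_trans (ltrN10 R)) // invr_gt0.
  have h2 : l - ln (1 + n%:R^-1) <= lq.
    have p1 : 0 < (1 - nu) / nu by rewrite divr_gt0.
    have p2 : 0 < 1 + n%:R^-1 :> R by rewrite addr_gt0 // invr_gt0.
    have p3 : 0 < (L.*2 - n).+1%:R / n.+1%:R :> R by rewrite divr_gt0 ?ltr0n.
    rewrite /l /lq -ln_div ?posrE // ler_ln ?posrE //; last exact: divr_gt0.
    rewrite [leLHS](_ : _ = (L.*2 - n)%:R / n.+1%:R).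
      by rewrite ler_wpM2r // ler_nat.
    rewrite enL -[n.+1%:R]natr1.
    have -> : N%:R = n%:R / nu by rewrite en mulrC mulKf // gt_eqF.
    by field; rewrite natr1 pnatr_eq0 /= !gt_eqF.
  by apply: le_trans h2; rewrite lerD2l lerN2.
have lq0 : 0 <= lq by apply: ln_ge0; rewrite ler_pdivlMr ?ltr0n // mul1r ler_nat; lia.
have tau0 : 0 <= tau by apply: sqrtr_ge0.
move=> hT; have hT' := ler_wpM2r lq0 hT.
have r0 : 0 <= n%:R / n.+1%:R :> R by rewrite divr_ge0.
have h1 := ler_wpM2l (mulr_ge0 tau0 r0) lqge.
have s0 : 0 < Num.sqrt L%:R :> R by rewrite sqrtr_gt0.
have tau_le : tau <= Num.sqrt L%:R.
  apply: ler_wsqrtr; rewrite ler_pdivrMr ?mulr_gt0 // eL.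
  have pi1 : 1 <= pi :> R by rewrite (le_trans _ (pi_ge2 R)) // ler1n.
  have : nu * (1 - nu) <= pi.
    apply: le_trans pi1; have : nu * (1 - nu) <= nu * 1 by rewrite ler_pM2l //; lra.
    lra.
  move=> hp; have : 0 <= 2 * L%:R :> R by rewrite mulr_ge0.
  by move=> /ler_wpM2r /(_ _ _ hp); congr (_ <= _); ring.
have n1 : n.+1%:R^-1 <= n%:R^-1 :> R by rewrite lef_pV2 ?posrE ?ltr0n // ler_nat.
have ni0 : 0 < n%:R^-1 :> R by rewrite invr_gt0.
have h2 : tau * (l - (1 + l) / n%:R) <= tau * (n%:R / n.+1%:R) * (l - n%:R^-1).
  rewrite -mulrA; apply: ler_wpM2l => //; rewrite r1.
  have : n.+1%:R^-1 * l <= n%:R^-1 * l by rewrite ler_wpM2r.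
  have : 0 <= n.+1%:R^-1 * n%:R^-1 :> R by rewrite mulr_ge0 // invr_ge0.
  set u := n.+1%:R^-1; set v := n%:R^-1; nra.
have h3 : tau * ((1 + l) / n%:R) <= (1 + l) / nu / Num.sqrt L%:R.
  have l1 : 0 <= (1 + l) / n%:R by rewrite divr_ge0 // addr_ge0.
  apply: le_trans (ler_wpM2r l1 tau_le) _.
  have -> : n%:R = 2 * nu * Num.sqrt L%:R ^+ 2 :> R by rewrite sqr_sqrtr ?ltW // en eL; ring.
  rewrite [leLHS](_ : _ = (1 + l) / nu / Num.sqrt L%:R / 2); last first.
    by field; rewrite !gt_eqF.
  rewrite ler_pdivrMr // ler_peMr ?ler1n //.
  by rewrite !divr_ge0 ?addr_ge0 // ltW.
apply: le_trans (lerD (le_trans h2 (le_trans h1 hT')) h3).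
by rewrite -mulrDr subrK mulrC.
Qed.

Lemma natr_half_le (N k : nat) (x : R) : x <= 1 / 2 -> k%:R = x * N%:R -> (k.*2 <= N)%N.
Proof.
move=> x2 ek; rewrite -(ler_nat R) -mul2n natrM ek mulrA -[leRHS]mul1r ler_wpM2r //; lra.
Qed.

Lemma page_sum_bound (nu f : R) : 0 < nu <= 1 / 2 -> 0 < f <= 1 / 2 ->
  exists2 C : R, 0 < C & forall N n L : nat, (3 <= N)%N ->
    n%:R = nu * N%:R -> L%:R = f * N%:R ->
    - (('C(N, n)%:R)^-1 * \sum_(k < n.+1)
         ('C(L, k) * 'C(N - L, n - k))%:R * ln (sector_weight R N n L k))
    <= binary_entropy nu * L%:R
       - (f == 1 / 2)%:R * `|ln ((1 - nu) / nu)|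
           * Num.sqrt (nu * (1 - nu) * N%:R / (2 * pi))
       + (f + ln (1 - f)) / 2
       + C * (f == 1 / 2)%:R / Num.sqrt L%:R
       + C / L%:R.
Proof.
move=> hnu hf; have [nu0 nu2] := andP hnu; have [f0 f2] := andP hf.
have l0 : 0 <= `|ln ((1 - nu) / nu)| by [].
(* The 1 absorbs the error 1 / (2 L) of [page_generic]; the other summand is the constant of
   [correction_le]. *)
exists (1 + (1 + `|ln ((1 - nu) / nu)|) / nu).
  by rewrite ltr_wpDr // divr_ge0 ?addr_ge0 // ltW.
move=> N n L N3 en eL.
have N0 : 0 < N%:R :> R by rewrite ltr0n; lia.
have pos (k : nat) (x : R) : 0 < x -> k%:R = x * N%:R -> (0 < k)%N.
  by move=> x0 ek; rewrite -(ltr0n R) ek mulr_gt0.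
have n2 := natr_half_le nu2 en; have L2 := natr_half_le f2 eL.
have n0 := pos _ _ nu0 en; have L0 := pos _ _ f0 eL.
have L0' : 0 < L%:R :> R by rewrite ltr0n.
have gen := @page_generic R nu f N n L n0 n2 L0 L2 N3 en eL.
set c0 := (1 + `|_|) / nu.
have c00 : 0 <= c0 by rewrite divr_ge0 ?addr_ge0 // ltW.
have invL : (2 * L%:R)^-1 <= (1 + c0) / L%:R.
  rewrite invfM; apply: ler_wpM2r; first by rewrite invr_ge0 ltW.
  by apply: (@le_trans _ _ 1); [lra|rewrite lerDl].
have [ef|nf] := eqVneq f (1 / 2); last first.
  have := @page_sum_le R N n L n2 L2.
  rewrite !mul0r !mulr0 !mul0r subr0 !addr0; lra.
have eN : N = L.*2.
  by apply/eqP; rewrite -(eqr_nat R) -mul2n natrM eL ef; apply/eqP; field.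
have nL : (n <= L)%N by lia.
have [j jn hj] := hyp_potential_ge R n0 nL.
have := correction_le hnu n0 nL eN en hj.
have := page_sum_half_le R L0 nL jn; rewrite -eN -/c0.
have s0 : 0 < (Num.sqrt L%:R)^-1 :> R by rewrite invr_gt0 sqrtr_gt0.
rewrite !mul1r mulr1 [(1 + c0) / Num.sqrt _]mulrDl mul1r.
move=> hp hc; lra.
Qed.

End PageBound.

Theorem theorem3 (R : realType) (nu f : R)
    (hnu : 0 < nu <= 1 / 2) (hf : 0 < f <= 1 / 2) :
  exists (C : R) (N0 : nat), 0 < C /\
    forall (N n L : nat), (N0 <= N)%N ->
      n%:R = nu * N%:R -> L%:R = f * N%:R ->
    forall (A : {set 'I_N}), #|A| = L ->
    forall (eps1 eps2 : R) (h : 'M[R[i]]_N)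
      (J : 'I_N -> 'I_N -> 'I_N -> 'I_N -> R[i]) (t : R),
      h \is hermsymmx ->
      ('C(N, n)%:R)^-1 *
        \sum_(S : {set 'I_N} | #|S| == n)
          vn_entropy (reduced A
            (evolved_state (hamiltonian eps1 eps2 h J) (slater R S) t))
      <= binary_entropy nu * L%:R
         - (f == 1 / 2)%:R * `|ln ((1 - nu) / nu)|
             * Num.sqrt (nu * (1 - nu) * N%:R / (2 * pi))
         + (f + ln (1 - f)) / 2
         + C * (f == 1 / 2)%:R / Num.sqrt L%:R
         + C / L%:R.
Proof.
have [C C0 bound] := page_sum_bound hnu hf.
(* N >= 3 because the third moment has N - 2 in its denominator. *)
exists C, 3%N; split=> // N n L N3 en eL A cA eps1 eps2 h J t hh.
have n2 := natr_half_le (proj2 (andP hnu)) en.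
have L2 := natr_half_le (proj2 (andP hf)) eL.
apply: le_trans (bound N n L N3 en eL); subst L; rewrite -mulrN.
apply: ler_wpM2l; first by rewrite invr_ge0.
apply: average_entropy_le => //.
- exact: sector_weight_ge0.
- by move=> k kL; apply: sector_weight_gt0 => //; lia.
by rewrite sum_sector_weight //; lia.
Qed.
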